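(* For $\theta\in\mathbb{R}$, let $\mathcal{M}(\theta,t)=\mathbb{E}[e^{\theta Q_t}]$ be the moment generating function of the number in system of an infinite server queue with periodic arrival rate $\lambda+\sum_{k=1}^\infty a_k\cos(kt)+b_k\sin(kt)>0$, arrival batch size $n\in\mathbb{Z}^+$, and exponential service rate $\mu>0$. Then $$\mathcal{M}(\theta,t)=\left(e^{-\mu t}(e^\theta-1)+1\right)^{Q_0}\exp\left(\sum_{j=1}^n\binom{n}{j}(e^\theta-1)^j\left(\frac{\lambda}{j\mu}(1-e^{-j\mu t})+\sum_{k=1}^\infty\frac{a_kj\mu-b_kk}{k^2+j^2\mu^2}\left(\cos(kt)-e^{-j\mu t}\right)\right)\right)$$ $$\cdot\exp\left(\sum_{j=1}^n\binom{n}{j}(e^\theta-1)^j\sum_{k=1}^\infty\frac{(a_kk+b_kj\mu)\sin(kt)}{k^2+j^2\mu^2}\right)$$ for all $t\ge0$, where $Q_0$ is the initial number in system.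
   Context: Model: batches of exactly $n$ customers arrive at the epochs of a non-homogeneous Poisson process whose intensity at time $t$ is the stated periodic function, i.e. a positive, locally integrable $2\pi$-periodic function given by its Fourier series with real coefficients $\lambda,a_k,b_k$. There are infinitely many servers, so each customer starts service immediately and leaves after an independent $\mathrm{Exp}(\mu)$ service time. $Q_t$ is the number of customers present at time $t$: the time-inhomogeneous Markov chain on $\{0,1,2,\dots\}$ with transitions $q\to q+n$ at rate equal to the arrival intensity and $q\to q-1$ at rate $\mu q$. $Q_0$ is a deterministic non-negative integer. *)

(* Defs.v *)
From HB Require Import structures.
From mathcomp Require Import all_boot all_order all_algebra finmap.
From mathcomp Require Import all_classical all_reals all_analysis.

Set Implicit Arguments.
Unset Strict Implicit.
Unset Printing Implicit Defensive.
Import Order.TTheory GRing.Theory Num.Theory.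
Import numFieldNormedType.Exports.

Local Open Scope classical_set_scope.
Local Open Scope ring_scope.

(* [r] is integrable over a period but its Fourier series is not required to
   converge pointwise: [lambda], [a], [b] are the Fourier coefficients of [r].
   The values [a 0] and [b 0] are irrelevant. *)
Definition fourier_coefficients (R : realType) (r : R -> R)
    (lambda : R) (a b : nat -> R) : Prop :=
  [/\ lambda = (pi *+ 2)^-1 *
        \int[lebesgue_measure]_(u in `[0, pi *+ 2]) r u,
      forall k, (0 < k)%N -> a k = pi^-1 *
        \int[lebesgue_measure]_(u in `[0, pi *+ 2]) (r u * cos (k%:R * u)) &
      forall k, (0 < k)%N -> b k = pi^-1 *
        \int[lebesgue_measure]_(u in `[0, pi *+ 2]) (r u * sin (k%:R * u))].

Definition mutually_independent d (T : measurableType d) (R : realType)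
    (P : probability T R) (I : choiceType) (G : I -> set_system T) : Prop :=
  forall (J : {fset I}) (E : I -> set T),
    (forall i, i \in J -> G i (E i)) ->
    P (\bigcap_(i in [set` J]) E i) = (\prod_(i <- J) P (E i))%E.

Section queue.
Context d (T : measurableType d) (R : realType) (P : probability T R).

(* Along a sequence of epochs tending to infinity the set below is finite, so
   that [fset_set] does not take its default value. *)
Definition arrivals (A : nat -> T -> R) (s t : R) (w : T) : nat :=
  #|` fset_set [set i | s < A i w <= t] |.

(* [A i] is the (i+1)-st epoch of a Poisson process on ]0, +oo[ with intensity
   function [r]. *)
Record poisson_epochs (r : R -> R) (A : nat -> {RV P >-> R}) : Prop := {
  epochs_increasing : {ae P, forall w,
    [/\ 0 < A 0 w, forall i, A i w < A i.+1 w & A ^~ w @ \oo --> +oo]} ;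
  poisson_increments : forall (s t : R) (k : nat), 0 <= s -> s < t ->
    P [set w | arrivals A s t w = k] =
    (poisson_pmf (\int[lebesgue_measure]_(u in `]s, t]) r u) k)%:E ;
  independent_increments : forall t : nat -> R, 0 <= t 0 ->
    {homo t : i j / (i <= j)%N >-> i <= j} ->
    mutually_independent P (fun i : nat =>
      g_sigma_algebra_preimage (arrivals A (t i) (t i.+1))) }.

(* [inl j]: the j-th of the [Q0] customers present at time 0;
   [inr (i, j)]: the j-th member of the i-th batch, of [n] customers. *)
Definition customer (Q0 n : nat) : choiceType := ('I_Q0 + nat * 'I_n)%type.

Definition arrival_time (Q0 n : nat) (A : nat -> T -> R) (c : customer Q0 n)
    (w : T) : R :=
  match c with inl _ => 0 | inr (i, _) => A i w end.

Definition number_in_system (Q0 n : nat) (A : nat -> T -> R)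
    (S : customer Q0 n -> T -> R) (t : R) (w : T) : nat :=
  #|` fset_set [set c : customer Q0 n |
       arrival_time A c w <= t < arrival_time A c w + S c w] |.

(* The service time [S (inl j)] of a customer present at time 0 is the residual
   one, which is again exponential with rate [mu] by lack of memory. *)
Record infinite_server_queue (r : R -> R) (mu : R) (Q0 n : nat)
    (A : nat -> {RV P >-> R}) (S : customer Q0 n -> {RV P >-> R}) : Prop := {
  poisson_arrivals : poisson_epochs r A ;
  exponential_services : forall (c : customer Q0 n) (V : set R),
    measurable V -> distribution P (S c) V = exponential_prob mu V ;
  independent_primitives :
    mutually_independent P (fun x : option (customer Q0 n) =>
      match x with
      | None => <<s \bigcup_i g_sigma_algebra_preimage (A i) >>
      | Some c => g_sigma_algebra_preimage (S c)
      end) }.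

End queue.

(* Main.v *)
Require Import Defs.
From HB Require Import structures.
From mathcomp Require Import all_boot all_order all_algebra finmap.
From mathcomp Require Import all_classical all_reals all_analysis.
From mathcomp Require Import measurable_realfun.
From mathcomp Require Import ring lra.

Set Implicit Arguments.
Unset Strict Implicit.
Unset Printing Implicit Defensive.
Import Order.TTheory GRing.Theory Num.Theory.
Import numFieldNormedType.Exports.

Local Open Scope classical_set_scope.
Local Open Scope ring_scope.

(** Put [z = e^theta - 1]. Then [e^(theta Q_t)] is a product over the customers,
    with a factor [1 + z] for those present at time [t] and [1] for the others.
    Given the epochs, a customer arrived at [u <= t] is still present with
    probability [e^(-mu (t - u))], independently of the others, so the
    conditional expectation of the product is [(1 + z e^(-mu t))^Q0] times the
    product of [g u = (1 + z e^(-mu (t - u)))^n] over the epochs [u <= t]. For a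
    Poisson process the expectation of the latter product is the exponential of
    the integral of [(g - 1) r] over [[0, t]]. By the binomial theorem this
    integral is a combination of the integrals of [r u e^(-c (t - u))], with
    [c = j mu], and it remains to read these off the Fourier coefficients of [r].

    Probability. Conditional expectations are replaced by a discretisation,
    because the intensity enters only through the numbers of epochs in
    intervals. Cut [[0, t]] into [m + 1] cells, and split the sample space
    according to the list [s] of the cells that contain the successive epochs
    up to [t] (there are countably many lists). On such an event
    ([cell_event]), moving each arrival to the left or to the right end of its
    cell bounds the product from both sides ([shifted_product_sandwich]); the
    bound involves only finitely many independent events
    ([integral_shifted_product]), and its integral is, up to the factor of the initial
    customers, that of a product of powers whose exponents are the numbers of
    epochs in the cells ([integral_weighted_arrivals_cell]). Summing over [s] and using the
    independence of the Poisson increments gives both bounds in closed form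
    ([generating_function_sandwich]); they are exponentials of Riemann sums with
    a common limit as [m] grows ([discretised_gf_cvg]).

    Fourier series. Let [Y t] be the integral of [r u e^(-c (t - u))] over all
    [u <= t]. It is periodic, the integral over [[0, t]] is
    [Y t - e^(-c t) Y 0], and [Y] is the convolution over a period of [r] with
    the periodised exponential. The function [r] is only integrable, so its
    series cannot be integrated term by term directly; but the Fourier partial
    sums of the periodised exponential are uniformly bounded
    ([exp_kernel_bounded]) and converge off the multiples of [2 pi]
    ([exp_kernel_cvg]), and dominated convergence yields the series of [Y] at
    every point. Its cosine and sine parts converge separately, being half the
    sum and half the difference of the series at [t] and at [- t]
    ([convolution_series]). *)

(** * The Fourier partial sums of the periodised exponential *)

Section kernel_bound.
Context {R : realType}.
Implicit Types (c v : R) (k N : nat).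

Lemma norm_sin_natmul k v : `|sin (k%:R * v)| <= k%:R * `|sin v|.
Proof.
elim: k => [|k IH]; first by rewrite !mul0r sin0 normr0.
rewrite -natr1 mulrDl mul1r sinD mulrDl mul1r.
apply: (le_trans (ler_normD _ _)); apply: lerD; rewrite normrM.
  by apply: le_trans IH; rewrite ler_piMr ?cos_max.
by rewrite ler_piMl ?cos_max.
Qed.

Lemma sin_half_telescope k v :
  2 * sin (v / 2) * sin (k%:R * v) =
  cos (k%:R * v - v / 2) - cos (k.+1%:R * v - v / 2).
Proof.
rewrite (_ : k.+1%:R * v - v / 2 = k%:R * v + v / 2); last by rewrite -natr1; lra.
by rewrite cosB cosD; lra.
Qed.

(** Summation by parts: multiplied by [2 sin (v / 2)], the sum becomes a
    telescoping sum with decreasing weights [1 / k]. *)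
Lemma abel_tail_bound p N v : (0 < p <= N)%N ->
  `|2 * sin (v / 2) * \sum_(p <= k < N) sin (k%:R * v) / k%:R| <= 2 / p%:R.
Proof.
move=> /andP[p0 pN].
pose C k := cos (k%:R * v - v / 2).
(* The boundary term of the summation by parts is kept on the left, so that
   each step costs exactly 1 / N - 1 / (N + 1). *)
suff H : `|2 * sin (v / 2) * (\sum_(p <= k < N) sin (k%:R * v) / k%:R)
           + C N / N%:R| <= 2 / p%:R - N%:R^-1.
  have N0 : 0 <= N%:R^-1 :> R by rewrite invr_ge0.
  have CN : `|C N / N%:R| <= N%:R^-1.
    rewrite normrM (ger0_norm N0). by apply: ler_piMl => //; exact: cos_max.
  by move: H CN; rewrite !ler_norml; lra.
elim: N pN => [|N IH]; first by rewrite leqn0 => /eqP p00; rewrite p00 in p0.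
rewrite leq_eqVlt => /orP[/eqP pN|].
  rewrite -pN big_geq// mulr0 add0r normrM normfV normr_nat.
  rewrite (_ : 2 / p%:R - _ = p%:R^-1); last by lra.
  by rewrite ler_piMl ?invr_ge0// cos_max.
rewrite ltnS => pN; have := IH pN; rewrite big_nat_recr//= mulrDr.
set X := 2 * _ * _.
have -> : 2 * sin (v / 2) * (sin (N%:R * v) / N%:R) = (C N - C N.+1) / N%:R.
  by rewrite mulrA sin_half_telescope.
have N0 : 0 < N%:R :> R by rewrite ltr0n (leq_trans p0).
have dN : 0 <= N%:R^-1 - N.+1%:R^-1 :> R.
  by rewrite subr_ge0 lef_pV2 ?posrE // ler_nat.
have CN : `|C N.+1 * (N%:R^-1 - N.+1%:R^-1)| <= N%:R^-1 - N.+1%:R^-1.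
  by rewrite normrM (ger0_norm dN) ler_piMl ?cos_max.
move: CN; rewrite !ler_norml.
move: (C N) (C N.+1) (N%:R^-1) (N.+1%:R^-1) => x y u w; lra.
Qed.

(** The terms are at most [2 |sin (v / 2)|], which controls those with
    [k <= 1 / |sin (v / 2)|]; summation by parts controls the others. *)
Lemma sum_sin_over_bounded N v : `|\sum_(1 <= k < N) sin (k%:R * v) / k%:R| <= 3.
Proof.
have sin_v : `|sin v| <= 2 * `|sin (v / 2)|.
  have {1}-> : v = (v / 2) *+ 2 by rewrite mulr2n; lra.
  rewrite sin_mulr2n -mulr_natl !normrM ger0_norm// ler_wpM2l// ler_piMl// cos_max//.
have head M : `|\sum_(1 <= k < M.+1) sin (k%:R * v) / k%:R|
               <= M%:R * (2 * `|sin (v / 2)|).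
  apply: (le_trans (ler_norm_sum _ _ _)).
  have -> : M%:R * (2 * `|sin (v / 2)|) = \sum_(1 <= k < M.+1) (2 * `|sin (v / 2)|).
    by rewrite sumr_const_nat subn1 mulr_natl.
  apply: ler_sum_nat => k /andP[k0 _];
  rewrite normrM normfV ler_pdivrMr ?normr_gt0 ?pnatr_eq0 -?lt0n//.
  by rewrite (le_trans (norm_sin_natmul _ _))// normr_nat mulrC ler_wpM2r.
have [s0|sneq0] := eqVneq (sin (v / 2)) 0.
  case: N => [|N]; first by rewrite big_geq// normr0.
  by rewrite (le_trans (head N))// s0 normr0 !mulr0.
have s0 : 0 < `|sin (v / 2)| by rewrite normr_gt0.
set m := Num.truncn (`|sin (v / 2)|^-1).
have /andP[m1 m2] : m%:R <= `|sin (v / 2)|^-1 < m.+1%:R.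
  by apply: truncn_itv; rewrite invr_ge0.
have hd M : (M <= m)%N -> `|\sum_(1 <= k < M.+1) sin (k%:R * v) / k%:R| <= 2.
  move=> Mm; rewrite (le_trans (head M))// mulrCA ler_piMr//.
  by rewrite -ler_pdivlMr// div1r (le_trans _ m1)// ler_nat.
have [Nm|mN] := leqP N m.+1.
  case: N Nm => [|N]; first by rewrite big_geq// normr0.
  by rewrite ltnS => /hd H; rewrite (le_trans H)//; lra.
rewrite (big_cat_nat _ (n := m.+1))//=; last exact: ltnW.
apply: (le_trans (ler_normD _ _)).
rewrite (_ : 3 = 2 + 1); last by lra.
apply: lerD; first exact: hd.
have := @abel_tail_bound m.+1 N v; rewrite /= => /(_ (ltnW mN)).
rewrite !normrM ger0_norm// -mulrA ler_pM2l// => H.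
rewrite -(ler_pM2l s0) mulr1 (le_trans H)//.
by rewrite -[leRHS]invrK lef_pV2 ?posrE ?ltr0n ?invr_gt0// ltW.
Qed.

Lemma sum_inv_sqr_bounded N : \sum_(1 <= k < N) (k%:R ^+ 2)^-1 <= 2 :> R.
Proof.
case: N => [|N]; first by rewrite big_geq.
case: N => [|N]; first by rewrite big_geq.
suff : \sum_(1 <= k < N.+2) (k%:R ^+ 2)^-1 <= 2 - N.+1%:R^-1 :> R.
  by move=> /le_trans; apply; rewrite lerBlDr lerDl invr_ge0.
elim: N => [|N IH]; first by rewrite big_nat1 expr1n invr1; lra.
rewrite big_nat_recr//=; apply: (le_trans (lerD IH (lexx _))).
set x : R := N.+1%:R; have x0 : 0 < x by rewrite ltr0n.
rewrite (_ : N.+2%:R = x + 1); last by rewrite natr1.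
rewrite -lerBrDr; have -> : 2 - (x + 1)^-1 - (x+1) ^- 2 = 2 - (x + 2) / (x + 1)^+2.
  by field; lra.
rewrite lerB// ler_pdivrMr; last by rewrite exprn_gt0//; lra.
by rewrite mulrC ler_pdivlMr//; nra.
Qed.

(** The Fourier partial sums of the function of period [2 pi] that equals
    [2 pi e^(-c v) / (1 - e^(-2 pi c))] on []0, 2 pi[]. *)
Definition exp_kernel c N v : R := c^-1 + 2 * \sum_(1 <= k < N)
  (c * cos (k%:R * v) + k%:R * sin (k%:R * v)) / (k%:R ^+ 2 + c ^+ 2).

(** The sine coefficients differ from [1 / k] by an absolutely summable
    sequence. *)
Lemma exp_kernel_bounded c : 0 < c -> exists B, forall N v, `|exp_kernel c N v| <= B.
Proof.
move=> c0; exists (c^-1 + 2 * (3 + (c + c ^+ 2) * 2)) => N v.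
apply: (le_trans (ler_normD _ _)); apply: lerD.
  by rewrite ger0_norm ?invr_ge0// ltW.
rewrite normrM ger0_norm// ler_wpM2l//.
have -> : \sum_(1 <= k < N) (c * cos (k%:R * v) + k%:R * sin (k%:R * v)) / (k%:R ^+ 2 + c ^+ 2)
  = \sum_(1 <= k < N) sin (k%:R * v) / k%:R +
    \sum_(1 <= k < N) (c * cos (k%:R * v) - c ^+ 2 * sin (k%:R * v) / k%:R) / (k%:R ^+ 2 + c ^+ 2).
  rewrite -big_split/=; apply: eq_big_nat => k /andP[k0 _].
  have k0' : 0 < k%:R :> R by rewrite ltr0n.
  by field; rewrite (gt_eqF k0') andbT gt_eqF// addr_gt0// exprn_gt0.
apply: (le_trans (ler_normD _ _)); apply: lerD; first exact: sum_sin_over_bounded.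
apply: (le_trans (ler_norm_sum _ _ _)).
apply: (@le_trans _ _ ((c + c ^+ 2) * \sum_(1 <= k < N) (k%:R ^+ 2)^-1)); last first.
  by rewrite ler_wpM2l ?sum_inv_sqr_bounded// addr_ge0 ?exprn_ge0// ltW.
rewrite mulr_sumr; apply: ler_sum_nat => k /andP[k0 _].
have k1 : 1 <= k%:R :> R by rewrite ler1n.
have k2 : 0 < k%:R ^+ 2 :> R by rewrite exprn_gt0//; lra.
have c2 : 0 < c ^+ 2 by rewrite exprn_gt0.
rewrite normrM ler_pM//.
  apply: (le_trans (ler_normB _ _)); apply: lerD.
    by rewrite normrM (gtr0_norm c0) ler_piMr ?cos_max// ltW.
  rewrite -mulrA normrM (gtr0_norm c2) ler_piMr//; first exact: ltW.
  rewrite normrM normfV normr_nat.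
  rewrite -(mul1r 1) ler_pM// ?sin_max//.
  by rewrite invf_le1//; lra.
rewrite gtr0_norm ?invr_gt0 ?addr_gt0// lef_pV2 ?posrE ?addr_gt0//.
by rewrite lerDl ltW.
Qed.

End kernel_bound.

Section kernel_limit.
Context {R : realType}.
Implicit Types (c v : R) (k N : nat).

Definition dirichlet_kernel N v : R := 1 + 2 * \sum_(1 <= k < N) cos (k%:R * v).

Lemma dirichlet_kernelE N v :
  sin (v / 2) * dirichlet_kernel N.+1 v = sin ((N%:R + 2^-1) * v).
Proof.
rewrite /dirichlet_kernel; elim: N => [|N IH].
  by rewrite big_geq// mulr0 addr0 mulr1 add0r mulrC.
rewrite big_nat_recr//= [2 * (_ + _)]mulrDr addrA mulrDr IH.
rewrite (_ : (N.+1%:R + 2^-1) * v = N.+1%:R * v + v / 2); last by lra.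
rewrite (_ : (N%:R + 2^-1) * v = N.+1%:R * v - v / 2); last by rewrite -natr1; field.
by rewrite sinB sinD; lra.
Qed.

(** The kernel solves [S' + c S = D] with [D] the Dirichlet kernel; this is what
    makes the limit of the kernel a multiple of [e^(-c v)]. *)
Lemma is_derive_expM_exp_kernel c N v : 0 < c ->
  is_derive v 1 (fun v => expR (c * v) * exp_kernel c N v)
    (expR (c * v) * dirichlet_kernel N v).
Proof.
move=> c0; rewrite /exp_kernel /dirichlet_kernel.
elim: N => [|N IH].
  under eq_fun do rewrite big_geq// mulr0 addr0.
  rewrite big_geq//.
  by apply: is_derive_eq; rewrite /GRing.scale/=; field; rewrite gt_eqF.
case: N IH => [IH|N IH].
  under eq_fun do rewrite big_geq// mulr0 addr0.
  rewrite big_geq//.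
  by apply: is_derive_eq; rewrite /GRing.scale/=; field; rewrite gt_eqF.
rewrite big_nat_recr//= [2 * (_ + _)]mulrDr addrA mulrDr.
under eq_fun do rewrite big_nat_recr//= [2 * (_ + _)]mulrDr addrA mulrDr.
apply: is_deriveD.
by apply: is_derive_eq; rewrite /GRing.scale/=; field; rewrite gt_eqF// addr_gt0 ?exprn_gt0.
Qed.

Lemma sin_natmul_pi k : sin (k%:R * pi) = 0 :> R.
Proof.
by apply/eqP; rewrite -normr_le0 (le_trans (norm_sin_natmul _ _))// sinpi normr0 mulr0.
Qed.

(** At [pi] the sines vanish and the series is absolutely convergent. *)
Lemma cvg_exp_kernel_pi c : 0 < c -> cvgn (fun N => exp_kernel c N pi).
Proof.
move=> c0.
pose u k : R := c * cos (k%:R * pi) / (k%:R ^+ 2 + c ^+ 2).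
have c2 : 0 < c ^+ 2 by rewrite exprn_gt0.
have cu : cvgn (series u).
  apply: normed_cvg; apply: nondecreasing_is_cvgn.
    by apply: (@nondecreasing_series _ (fun k => `|u k|) xpredT 0).
  exists (c^-1 + c * 2) => _ [N _ <-]; rewrite [leLHS](_ : _ = \sum_(0 <= k < N) `|u k|)//.
  case: N => [|N].
    by rewrite big_geq// addr_ge0 ?invr_ge0 ?mulr_ge0// ltW.
  rewrite big_nat_recl// lerD//.
    rewrite /u mul0r cos0 expr0n/= add0r mulr1 ger0_norm; last first.
      by rewrite divr_ge0 ?exprn_ge0 // ltW.
    by rewrite (_ : c / c ^+ 2 = c^-1)//; field; rewrite gt_eqF.
  apply: le_trans (_ : c * \sum_(1 <= k < N.+1) (k%:R ^+ 2)^-1 <= _); last first.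
    by rewrite ler_wpM2l ?sum_inv_sqr_bounded// ltW.
  rewrite big_add1 /= mulr_sumr; apply: ler_sum_nat => k _.
  have k2 : 0 < k.+1%:R ^+ 2 :> R by rewrite exprn_gt0// ltr0n.
  rewrite normrM ler_pM//; first by rewrite normrM (gtr0_norm c0) ler_piMr ?cos_max// ltW.
  rewrite gtr0_norm ?invr_gt0 ?addr_gt0// lef_pV2 ?posrE ?addr_gt0//.
  by rewrite lerDl ltW.
have -> : (fun N => exp_kernel c N pi) =
    (fun N => c^-1 + 2 * [sequence \sum_(1 <= k < N) u k]_N N).
  apply/funext => N; rewrite /exp_kernel/=.
  by under eq_bigr do rewrite sin_natmul_pi mulr0 addr0.
apply: is_cvgD; first exact: is_cvg_cst.
by apply: is_cvgMl_tmp; rewrite is_cvg_series_restrict.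
Qed.

(** Away from the multiples of [2 pi], the integral of
    [e^(c v) sin (M v) / sin (v / 2)] is [O(1 / M)]. Instead of integrating by
    parts, the boundary term is added to the primitive and the mean value
    theorem is applied to the sum [G], whose derivative is [phi v cos (M v) / M]. *)
Lemma exp_kernel_cauchy c a b : 0 < c -> 0 < a -> a <= b -> b < pi *+ 2 ->
  exists K : R, forall N, `|expR (c * b) * exp_kernel c N.+1 b -
     expR (c * a) * exp_kernel c N.+1 a| <= K / (N%:R + 2^-1).
Proof.
move=> c0 a0 ab b2.
have s0 v : v \in `[a, b]%R -> sin (v / 2) != 0.
  rewrite in_itv/= => /andP[av vb]; rewrite gt_eqF// sin_gt0_pi//.
  by move: b2; rewrite mulr2n => b2; apply/andP; split; lra.
pose phi v := expR (c * v) * (c / sin (v / 2) - cos (v / 2) / (2 * sin (v / 2) ^+ 2)).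
have dphi v : v \in `[a, b]%R -> derivable phi v 1.
  move=> /s0 vs.
  have ? : 2 * sin (v / 2) ^+ 2 != 0 by rewrite mulf_neq0 ?sqrf_eq0.
  by apply: ex_derive.
have [x _ phix] : exists2 x, x \in `[a, b]%R &
    forall v, v \in `[a, b]%R -> `|phi v| <= `|phi x|.
  apply: EVT_max => //.
  have cphi := derivable_within_continuous dphi.
  move=> y; apply: continuous_comp; first exact: cphi.
  exact: norm_continuous.
pose psi v := expR (c * v) / sin (v / 2).
exists (`|phi x| * (b - a) + (`|psi b| + `|psi a|)) => N.
set M := N%:R + 2^-1.
have M0 : 0 < M by rewrite ltr_wpDl// invr_gt0.
pose G v := expR (c * v) * exp_kernel c N.+1 v + psi v * (cos (M * v) / M).
have dG v : v \in `[a, b]%R -> is_derive v 1 G (phi v * (cos (M * v) / M)).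
  move=> /[dup] vab /s0 vs.
  have d1 := is_derive_expM_exp_kernel N.+1 v c0.
  have Hd : dirichlet_kernel N.+1 v = sin (M * v) / sin (v / 2).
    by rewrite -dirichlet_kernelE mulrAC mulfV// mul1r.
  rewrite /G /psi; apply: is_derive_eq.
  rewrite /GRing.scale/= Hd /phi.
  by field; rewrite vs gt_eqF.
have [y yab GbGa] := MVT_segment ab (fun v vab => dG v (subset_itv_oo_cc vab))
  (derivable_within_continuous (fun v vab => @ex_derive _ _ _ _ _ _ _ (dG v vab))).
have -> : expR (c * b) * exp_kernel c N.+1 b - expR (c * a) * exp_kernel c N.+1 a =
  (phi y * cos (M * y) * (b - a) - psi b * cos (M * b) + psi a * cos (M * a)) / M.
  have -> : expR (c * b) * exp_kernel c N.+1 b - expR (c * a) * exp_kernel c N.+1 a =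
    (G b - G a) - psi b * (cos (M * b) / M) + psi a * (cos (M * a) / M) by rewrite /G; ring.
  by rewrite GbGa; field; rewrite gt_eqF.
rewrite normrM [X in _ * X]gtr0_norm ?invr_gt0// ler_pM2r ?invr_gt0//.
have Hc p v : `|p * cos v| <= `|p| by rewrite normrM ler_piMr ?cos_max.
rewrite addrA; apply: (le_trans (ler_normD _ _)); apply: lerD => //.
apply: (le_trans (ler_normB _ _)); apply: lerD => //.
rewrite normrM (ger0_norm (_ : 0 <= b - a)) ?subr_ge0//.
by rewrite ler_wpM2r ?subr_ge0// (le_trans (Hc _ _))// phix.
Qed.

(** The product of the kernel by [e^(c v)] has the same limit at [v] as at [pi]. *)
Lemma exp_kernel_cvg c : 0 < c -> exists s : R, forall v, 0 < v < pi *+ 2 ->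
  exp_kernel c N v @[N --> \oo] --> s * expR (- (c * v)).
Proof.
move=> c0; have cpi := cvg_exp_kernel_pi c0.
exists (expR (c * pi) * limn (fun N => exp_kernel c N pi)) => v /andP[v0 v2].
have pi2 : pi < pi *+ 2 :> R by rewrite mulr2n ltrDl pi_gt0.
have [K HK] : exists K : R, forall N, `|expR (c * v) * exp_kernel c N.+1 v -
     expR (c * pi) * exp_kernel c N.+1 pi| <= K / (N%:R + 2^-1).
  have [vpi|piv] := leP v pi.
    have [K HK] := exp_kernel_cauchy c0 v0 vpi pi2.
    by exists K => N; rewrite distrC.
  exact: exp_kernel_cauchy c0 (pi_gt0 _) (ltW piv) v2.
rewrite -(cvg_shiftS (fun N => exp_kernel c N v)).
have e0 : expR (c * v) * exp_kernel c N.+1 v - expR (c * pi) * exp_kernel c N.+1 pi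
    @[N --> \oo] --> (0 : R).
  apply: norm_cvg0; apply: (@squeeze_cvgr _ _ _ _ (fun=> 0) (fun N => (2 * `|K|) * N.+1%:R^-1)).
  - near=> N; rewrite normr_ge0/= (le_trans (HK N))// mulrC -mulrA mulrCA mulrC.
    have N0 : 0 <= N%:R :> R by [].
    apply: (le_trans (ler_norm _)); rewrite normrM ler_wpM2l//.
    rewrite ger0_norm; last by rewrite invr_ge0; lra.
    by rewrite -[leRHS]invrK lef_pV2 ?posrE ?invr_gt0 ?divr_gt0//; lra.
  - exact: cvg_cst.
  - by rewrite -[X in _ --> X](mulr0 (2 * `|K|)); apply: cvgMl_tmp; exact: cvg_harmonic.
have cpi' : exp_kernel c N.+1 pi @[N --> \oo] --> limn (fun N => exp_kernel c N pi).
  by rewrite (cvg_shiftS (fun N => exp_kernel c N pi)).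
have H : expR (- (c * v)) *
  (expR (c * v) * exp_kernel c N.+1 v - expR (c * pi) * exp_kernel c N.+1 pi +
   expR (c * pi) * exp_kernel c N.+1 pi) @[N --> \oo]
  --> expR (- (c * v)) * (0 + expR (c * pi) * limn (fun N => exp_kernel c N pi)).
  by apply: cvgMl_tmp; apply: cvgD => //; exact: cvgMl_tmp.
rewrite add0r in H.
rewrite [_ * expR _]mulrC.
rewrite (_ : (fun N => exp_kernel c N.+1 v) = (fun N => expR (- (c * v)) *
  (expR (c * v) * exp_kernel c N.+1 v - expR (c * pi) * exp_kernel c N.+1 pi +
   expR (c * pi) * exp_kernel c N.+1 pi)))//.
by apply/funext => N /=; rewrite subrK mulrA -expRD addNr expR0 mul1r.
Unshelve. all: by end_near. Qed.

End kernel_limit.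

(** * Convolution of a periodic function with an exponential *)

Section fourier_integral.
Context {R : realType}.
Notation leb := (@lebesgue_measure R).
Implicit Types (c t u : R) (k N : nat).

Lemma integrable_mul_continuous (f g : R -> R) a b :
  leb.-integrable `[a, b] (EFin \o f) -> continuous g ->
  leb.-integrable `[a, b] (EFin \o (fun u => f u * g u)).
Proof.
move=> intf cg; rewrite (_ : EFin \o _ = ((EFin \o f) \* (EFin \o g))%E); last by apply/funext.
apply: integrableMl => //;
  first by apply: measurable_funTS; exact: continuous_measurable_fun.
have /compact_bounded[M [Mr HM]] : compact (g @` `[a, b]).
  apply: continuous_compact; [exact: continuous_subspaceT|exact: segment_compact].
by exists M; split => // x Mx y aby; apply: HM => //; exists y.
Qed.

Lemma continuous_exp_kernel c N : continuous (exp_kernel c N : R -> R).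
Proof.
move=> x; apply: differentiable_continuous; apply/derivable1_diffP; rewrite /exp_kernel.
have H M : derivable (fun v : R => \sum_(1 <= k < M.+1)
    (c * cos (k%:R * v) + k%:R * sin (k%:R * v)) / (k%:R ^+ 2 + c ^+ 2)) x 1.
  elim: M => [|M IH]; first by under eq_fun do rewrite big_geq//; apply: ex_derive.
  by under eq_fun do rewrite big_nat_recr//=; apply: derivableD => //; apply: ex_derive.
case: N => [|N]; first by under eq_fun do rewrite big_geq//; apply: ex_derive.
by apply: derivableD; [exact: derivable_cst|exact: derivableZ (H N)].
Qed.

Lemma cst_sub_continuous t : continuous (fun u : R => t - u).
Proof. by move=> x; apply: continuousB; [exact: cst_continuous|]. Qed.

Lemma cos_natmul_continuous k : continuous (fun u : R => cos (k%:R * u)).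
Proof. by move=> x; apply: continuous_comp; [exact: mulrl_continuous|exact: continuous_cos]. Qed.

Lemma sin_natmul_continuous k : continuous (fun u : R => sin (k%:R * u)).
Proof. by move=> x; apply: continuous_comp; [exact: mulrl_continuous|exact: continuous_sin]. Qed.

Lemma Rintegral_mul_exp_kernel (f : R -> R) c N t :
  leb.-integrable `[0, pi *+ 2] (EFin \o f) ->
  \int[leb]_(u in `[0, pi *+ 2]) (f u * exp_kernel c N (t - u)) =
  c^-1 * \int[leb]_(u in `[0, pi *+ 2]) f u + 2 * \sum_(1 <= k < N)
   ((c * cos (k%:R * t) + k%:R * sin (k%:R * t)) / (k%:R ^+ 2 + c ^+ 2) *
      \int[leb]_(u in `[0, pi *+ 2]) (f u * cos (k%:R * u)) +
    (c * sin (k%:R * t) - k%:R * cos (k%:R * t)) / (k%:R ^+ 2 + c ^+ 2) *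
      \int[leb]_(u in `[0, pi *+ 2]) (f u * sin (k%:R * u))).
Proof.
move=> intf.
have icos k p : leb.-integrable `[0, pi *+ 2]
    (EFin \o (fun u : R => f u * (p * cos (k%:R * u)))).
  apply: integrable_mul_continuous => // x; apply: continuousM.
    exact: cst_continuous.
  exact: cos_natmul_continuous.
have isin k p : leb.-integrable `[0, pi *+ 2]
    (EFin \o (fun u : R => f u * (p * sin (k%:R * u)))).
  apply: integrable_mul_continuous => // x; apply: continuousM.
    exact: cst_continuous.
  exact: sin_natmul_continuous.
have ckernel M : continuous (fun u : R => exp_kernel c M (t - u)).
  move=> x; apply: (@continuous_comp _ _ _ (fun u => t - u) (exp_kernel c M)).
    exact: cst_sub_continuous.
  exact: continuous_exp_kernel.
have int0 N0 : (N0 <= 1)%N ->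
  \int[leb]_(u in `[0, pi *+ 2]) (f u * exp_kernel c N0 (t - u)) =
  c^-1 * \int[leb]_(u in `[0, pi *+ 2]) f u.
  move=> N1; rewrite -RintegralZl//; apply: eq_Rintegral => u _.
  by rewrite /exp_kernel big_geq// mulr0 addr0 mulrC.
elim: N => [|N IH]; first by rewrite int0// big_geq// mulr0 addr0.
case: N IH => [|N] IH; first by rewrite int0// big_geq// mulr0 addr0.
rewrite big_nat_recr//= mulrDr addrA -IH.
set p := _ / _; set q := _ / _.
have -> : \int[leb]_(u in `[0, pi *+ 2]) (f u * exp_kernel c N.+2 (t - u)) =
  \int[leb]_(u in `[0, pi *+ 2]) (f u * exp_kernel c N.+1 (t - u) +
    (f u * (2 * p * cos (N.+1%:R * u)) + f u * (2 * q * sin (N.+1%:R * u)))).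
  apply: eq_Rintegral => u _; rewrite -!mulrDr /exp_kernel big_nat_recr//=.
  by rewrite mulrBr cosB sinB /p /q; ring.
rewrite RintegralD//; last 2 first.
- exact: integrable_mul_continuous.
- rewrite (_ : EFin \o _ = ((EFin \o (fun u => f u * (2 * p * cos (N.+1%:R * u)))%R) \+
    (EFin \o (fun u => f u * (2 * q * sin (N.+1%:R * u)))%R))%E); last by apply/funext.
  exact: integrableD.
rewrite RintegralD// mulrDr; congr (_ + (_ + _)).
- rewrite mulrA -RintegralZl//; first by apply: eq_Rintegral => u _; rewrite mulrCA mulrA.
  exact: (integrable_mul_continuous intf (@cos_natmul_continuous _)).
- rewrite mulrA -RintegralZl//; first by apply: eq_Rintegral => u _; rewrite mulrCA mulrA.
  exact: (integrable_mul_continuous intf (@sin_natmul_continuous _)).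
Qed.

End fourier_integral.

Section fourier_limit.
Context {R : realType}.
Notation leb := (@lebesgue_measure R).
Implicit Types (c t u : R) (k N : nat).

Lemma cos_natmulD2pi k t m : cos (k%:R * (t + pi *+ 2 *+ m)) = cos (k%:R * t) :> R.
Proof.
rewrite mulrDr [k%:R * (_ *+ m)]mulr_natl -(mulrnA (pi *+ 2)).
by rewrite (periodicn (@cosD2pi R)).
Qed.

Lemma sin_natmulD2pi k t m : sin (k%:R * (t + pi *+ 2 *+ m)) = sin (k%:R * t) :> R.
Proof.
rewrite mulrDr [k%:R * (_ *+ m)]mulr_natl -(mulrnA (pi *+ 2)).
by rewrite (periodicn (@sinD2pi R)).
Qed.

Lemma exp_kernelD2pi c N v : exp_kernel c N (v + pi *+ 2) = exp_kernel c N v :> R.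
Proof.
rewrite /exp_kernel; congr (_ + _ * _); apply: eq_bigr => k _.
by rewrite -[pi *+ 2]mulr1n cos_natmulD2pi sin_natmulD2pi.
Qed.

Lemma continuous_expM c : continuous (fun u : R => expR (c * u)).
Proof. by move=> x; apply: continuous_comp; [exact: mulrl_continuous|exact: continuous_expR]. Qed.

(** For [u] on the right of [t], the argument [t - u] is negative and periodicity
    brings it back to []0, 2 pi[], whence the extra factor [e^(-2 pi c)]. *)
Lemma Rintegral_mul_exp_kernel_cvg (f : R -> R) c s t : 0 < c ->
  (forall v, 0 < v < pi *+ 2 -> exp_kernel c N v @[N --> \oo] --> s * expR (- (c * v))) ->
  leb.-integrable `[0, pi *+ 2] (EFin \o f) ->
  0 <= t <= pi *+ 2 ->
  \int[leb]_(u in `[0, pi *+ 2]) (f u * exp_kernel c N (t - u)) @[N --> \oo] -->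
  s * expR (- (c * t)) * (\int[leb]_(u in `[0, t]) (f u * expR (c * u)) +
     expR (- (c * (pi *+ 2))) * (\int[leb]_(u in `[0, pi *+ 2]) (f u * expR (c * u)) -
                    \int[leb]_(u in `[0, t]) (f u * expR (c * u)))).
Proof.
move=> c0 Ss intf /andP[t0 t2].
have [B HB] := @exp_kernel_bounded R c c0.
pose w u := if u <= t then 1 else expR (- (c * (pi *+ 2))).
pose F u := f u * (s * expR (- (c * t)) * (expR (c * u) * w u)).
have mf := measurable_int _ intf.
have intexp : leb.-integrable `[0, pi *+ 2] (EFin \o (fun u => f u * expR (c * u))).
  by apply: integrable_mul_continuous => //; exact: continuous_expM.
have sub1 : `[0, t] `<=` `[0, pi *+ 2 :> R].
  by apply: subset_itvl; rewrite bnd_simp.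
have sub2 : `]t, pi *+ 2] `<=` `[0, pi *+ 2 :> R].
  by apply: subset_itvr; rewrite bnd_simp.
have mw : measurable_fun setT w.
  by apply: measurable_fun_if => //; apply: measurable_fun_ler.
have -> : s * expR (- (c * t)) * (\int[leb]_(u in `[0, t]) (f u * expR (c * u)) +
     expR (- (c * (pi *+ 2))) * (\int[leb]_(u in `[0, pi *+ 2]) (f u * expR (c * u)) -
                    \int[leb]_(u in `[0, t]) (f u * expR (c * u)))) =
   \int[leb]_(u in `[0, pi *+ 2]) F u.
  set K := s * _; set q := expR _.
  have intF : leb.-integrable `[0, pi *+ 2] (EFin \o F).
    rewrite (_ : EFin \o F = ((EFin \o (fun u => f u * expR (c * u))%R) \*
      (EFin \o (fun u => K * w u)%R))%E); last first.
      by apply/funext => u /=; rewrite -EFinM /F /K; congr (_%:E); ring.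
    apply: integrableMl => //; first by apply: measurable_funTS; exact: measurable_funM.
    exists (`|K| * (1 + q)); split=> [|M HM]; first exact: num_real.
    move=> u _ /=; apply: le_trans (ltW HM).
    rewrite normrM ler_wpM2l// /w; case: ifP => _; rewrite ger0_norm ?expR_ge0//.
      by rewrite lerDl expR_ge0.
    by rewrite lerDr.
  have FB : \int[leb]_(u in `[0, pi *+ 2]) F u =
      \int[leb]_(u in `[0, t]) F u + \int[leb]_(u in `]t, pi *+ 2]) F u.
    by rewrite -(Rintegral_itvB (x := t) intF) ?bnd_simp// addrC subrK.
  rewrite FB (Rintegral_itvB (x := t) intexp) ?bnd_simp// mulrDr; congr (_ + _).
    rewrite -RintegralZl//; last exact: integrableS intexp.
    apply: eq_Rintegral => u; rewrite inE/= in_itv/= => /andP[_ ut].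
    by rewrite /F /w ut /K; ring.
  rewrite mulrA -RintegralZl//; last exact: integrableS intexp.
  apply: eq_Rintegral => u; rewrite inE/= in_itv/= => /andP[tu _].
  by rewrite /F /w leNgt tu/= /K /q; ring.
have mF : measurable_fun `[0, pi *+ 2] (EFin \o F).
  apply/measurable_EFinP; apply: measurable_funM; first exact/measurable_EFinP.
  apply: measurable_funTS; apply: measurable_funM => //; apply: measurable_funM => //.
  apply: measurable_realfun.continuous_measurable_fun; exact: continuous_expM.
have [] := @dominated_convergence _ _ R leb `[0, pi *+ 2] (measurable_itv _)
  (fun N u => (f u * exp_kernel c N (t - u))%:E) (EFin \o F) (fun u => (B * `|f u|)%:E).
- move=> N. apply/measurable_EFinP; apply: measurable_funM; first exact/measurable_EFinP.
  apply: measurable_funTS; apply: measurable_realfun.continuous_measurable_fun => x.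
  apply: (@continuous_comp _ _ _ (fun u => t - u) (exp_kernel c N)).
    exact: cst_sub_continuous.
  exact: continuous_exp_kernel.
- exact: mF.
- have cvgF u : 0 < u < pi *+ 2 -> u != t ->
      f u * exp_kernel c N (t - u) @[N --> \oo] --> F u.
    move=> /andP[u0 u2] ut; apply: cvgMl_tmp; rewrite /w.
    have [utt|tu] := leP u t.
      rewrite mulr1 -mulrA -expRD (_ : - (c * t) + _ = - (c * (t - u))); last by ring.
      by apply: Ss; rewrite subr_gt0 lt_neqAle ut utt/=; lra.
    rewrite -mulrA -!expRD (_ : - (c * t) + _ = - (c * (t - u + pi *+ 2))); last by ring.
    under eq_fun do rewrite -exp_kernelD2pi.
    by apply: Ss; apply/andP; split; lra.
  exists [set 0; t; pi *+ 2]; split.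
  + by apply: measurableU => //; exact: measurableU.
  + apply: countable_lebesgue_measure0; apply: finite_set_countable.
    by rewrite !finite_setU; split => //; split.
  + move=> u /= uN; apply: contrapT => /not_orP[/not_orP[u0 ut] u2]; apply: uN.
    rewrite in_itv/= => /andP[u0' u2']; apply: cvg_EFin; first exact: nearW.
    apply: cvgF; last exact/eqP.
    by rewrite !lt_neqAle u0' u2' !andbT; apply/andP; split; apply/eqP => // /esym.
- rewrite (_ : (fun u => _) = (fun u => B%:E * `|(EFin \o f) u|)%E); last by apply/funext.
  by apply: integrableZl => //; exact: integrable_abse.
- apply/aeW => u N _; rewrite /= lee_fin normrM mulrC ler_wpM2r//.
move=> iF _ cF.
rewrite -(fineK (integrable_fin_num _ iF))// in cF.
exact: fine_cvg cF.
Qed.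

End fourier_limit.

Section translation.
Context {R : realType}.
Notation leb := (@lebesgue_measure R).

Lemma lebesgue_measure_translate (p : R) (A : set R) : measurable A ->
  pushforward leb (+%R p : R -> measurableTypeR R) A = leb A.
Proof.
move=> mA; apply/esym/lebesgue_measure_unique => //=; first exact: measurable_funD.
move=> _ _ [[a b]] _ <-.
rewrite /pushforward (_ : _ @^-1` _ = `]a - p, b - p]%classic); last first.
  by apply/seteqP; split=> x /=; rewrite /= !in_itv/= => /andP[? ?]; apply/andP; split; lra.
rewrite !lebesgue_measure_itv/= !lte_fin ltrD2r; case: ifP => // _.
by rewrite -!EFinD; congr (_%:E); ring.
Qed.

Lemma ge0_Rintegral_translate (f : R -> R) p a b :
  measurable_fun setT f -> (forall x, 0 <= f x) ->
  \int[leb]_(x in `[p + a, p + b]) f x = \int[leb]_(x in `[a, b]) f (p + x).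
Proof.
move=> mf f0; rewrite /Rintegral; congr fine.
have mp : measurable_fun [set: measurableTypeR R]
    (+%R p : measurableTypeR R -> measurableTypeR R) by exact: measurable_funD.
rewrite (_ : `[a, b]%classic = (+%R p : R -> measurableTypeR R) @^-1` `[p + a, p + b]); last first.
  by apply/seteqP; split=> x /=; rewrite /= !in_itv/= !lerD2l.
have := @ge0_integral_pushforward _ _ _ (measurableTypeR R) _ _ mp leb
  `[p + a, p + b] (EFin \o f) (measurable_itv _).
move=> <- //; last 2 first.
- by apply: measurable_funTS; apply/measurable_EFinP.
- by move=> x _; rewrite lee_fin.
by apply: eq_measure_integral => /= A mA _; rewrite lebesgue_measure_translate.
Qed.

End translation.

Section fourier_convolution.
Context {R : realType}.
Notation leb := (@lebesgue_measure R).
Implicit Types (c t u : R) (k N : nat).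

Lemma Rintegral_FTC2 (f F : R -> R) (a b : R) : a < b -> continuous f ->
  (forall x : R, is_derive x (1 : R) F (f x)) -> \int[leb]_(x in `[a, b]) f x = F b - F a.
Proof.
move=> ab cf dF; rewrite /Rintegral (@continuous_FTC2 _ f F)//.
- exact: continuous_subspaceT.
- have cF : continuous F.
    move=> x; apply: differentiable_continuous; apply/derivable1_diffP.
    by have := dF x => ?; exact: ex_derive.
  split.
  + by move=> x _; have := dF x => ?; exact: ex_derive.
  + by apply: cvg_at_right_filter; exact: cF.
  + by apply: cvg_at_left_filter; exact: cF.
- by move=> x _; rewrite derive1E; have := dF x => ?; exact: derive_val.
Qed.

Lemma Rintegral_expM c a b : 0 < c -> a < b ->
  \int[leb]_(u in `[a, b]) expR (c * u) = (expR (c * b) - expR (c * a)) / c.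
Proof.
move=> c0 ab.
have dF (x : R) : is_derive x (1 : R) (fun u => expR (c * u) / c) (expR (c * x)).
  by apply: is_derive_eq; rewrite /GRing.scale/=; field; rewrite gt_eqF.
by rewrite (Rintegral_FTC2 ab (@continuous_expM _ c) dF) mulrBl.
Qed.

Lemma Rintegral_cos_period k : (0 < k)%N ->
  \int[leb]_(u in `[0, pi *+ 2]) cos (k%:R * u) = 0.
Proof.
move=> k0.
have dF (x : R) : is_derive x (1 : R) (fun u => sin (k%:R * u) / k%:R) (cos (k%:R * x)).
  by apply: is_derive_eq; rewrite /GRing.scale/=; field; rewrite pnatr_eq0 -lt0n.
have p2 : 0 < pi *+ 2 :> R by rewrite mulrn_wgt0// pi_gt0.
rewrite (Rintegral_FTC2 p2 (@cos_natmul_continuous _ k) dF).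
by rewrite -[pi *+ 2]add0r -[pi *+ 2]mulr1n sin_natmulD2pi subrr.
Qed.

Lemma Rintegral_sin_period k : (0 < k)%N ->
  \int[leb]_(u in `[0, pi *+ 2]) sin (k%:R * u) = 0.
Proof.
move=> k0.
have dF (x : R) : is_derive x (1 : R) (fun u => - cos (k%:R * u) / k%:R) (sin (k%:R * x)).
  by apply: is_derive_eq; rewrite /GRing.scale/=; field; rewrite pnatr_eq0 -lt0n.
have p2 : 0 < pi *+ 2 :> R by rewrite mulrn_wgt0// pi_gt0.
rewrite (Rintegral_FTC2 p2 (@sin_natmul_continuous _ k) dF).
by rewrite -[pi *+ 2]add0r -[pi *+ 2]mulr1n cos_natmulD2pi subrr.
Qed.

(** The constant is found by integrating the kernel over a period, where only
    its mean value [1 / c] contributes. *)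
Lemma exp_kernel_cvg_normalised c : 0 < c -> exists s : R,
  s * (1 - expR (- (c * (pi *+ 2)))) = pi *+ 2 /\
  forall v, 0 < v < pi *+ 2 ->
    exp_kernel c N v @[N --> \oo] --> s * expR (- (c * v)).
Proof.
move=> c0; have [s Ss] := exp_kernel_cvg c0; exists s; split => //.
have p2 : 0 < pi *+ 2 :> R by rewrite mulrn_wgt0// pi_gt0.
have i1 : leb.-integrable `[0, pi *+ 2] (EFin \o cst (1 : R)).
  apply: continuous_compact_integrable; first exact: segment_compact.
  by apply: continuous_subspaceT; exact: cst_continuous.
have H1 : \int[leb]_(u in `[0, pi *+ 2]) cst 1 u = pi *+ 2 :> R.
  rewrite Rintegral_cst//= mul1r lebesgue_measure_itv/= lte_fin p2.
  by rewrite -EFinD/= subr0.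
have H2 N : \int[leb]_(u in `[0, pi *+ 2]) (cst 1 u * exp_kernel c N (0 - u)) = c^-1 * (pi *+ 2).
  rewrite Rintegral_mul_exp_kernel// H1 big_nat_cond big1 ?mulr0 ?addr0// => k /andP[/andP[k0 _] _].
  under eq_Rintegral do rewrite /= mul1r.
  rewrite Rintegral_cos_period// mulr0 add0r.
  under eq_Rintegral do rewrite /= mul1r.
  by rewrite Rintegral_sin_period// mulr0.
have := Rintegral_mul_exp_kernel_cvg (t := 0) c0 Ss i1.
rewrite lexx ltW//= => /(_ isT).
rewrite mulr0 oppr0 expR0 mulr1 set_itv1 Rintegral_set1 subr0 add0r.
under [X in _ * (_ * X)]eq_Rintegral do rewrite mul1r.
rewrite Rintegral_expM// mulr0 expR0.
under eq_fun do rewrite H2.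
move=> /cvg_lim; rewrite lim_cst// => /(_ (@Rhausdorff _)) E.
transitivity (c * (c^-1 * (pi *+ 2))); last by rewrite mulrA mulfV ?mul1r// gt_eqF.
have qQ : expR (- (c * (pi *+ 2))) * expR (c * (pi *+ 2)) = 1 by rewrite -expRD addNr expR0.
rewrite E; move: qQ; set q := expR (- _); set Q := expR _ => qQ.
rewrite [RHS](_ : _ = s * (q * Q - q)); first by rewrite qQ.
by field; rewrite gt_eqF.
Qed.

Lemma locally_integrable_itv (f : R -> R) a b : locally_integrable setT f ->
  leb.-integrable `[a, b] (EFin \o f).
Proof.
move=> [mf _ lf]; apply/integrableP; split.
  by apply/measurable_EFinP; exact: measurable_funTS.
by have := lf `[a, b]%classic; apply => //; exact: segment_compact.
Qed.

Lemma periodic_ind (p : R) (Q : R -> Prop) : 0 < p ->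
  (forall t, 0 <= t <= p -> Q t) -> (forall t, 0 <= t -> Q t -> Q (p + t)) ->
  forall t, 0 <= t -> Q t.
Proof.
move=> p0 Q0 QS.
have H m t : 0 <= t <= p -> Q (m%:R * p + t).
  move=> /andP[t0 tp]; elim: m => [|m IH]; first by rewrite mul0r add0r; apply: Q0; rewrite t0.
  rewrite -natr1 mulrDl mul1r addrAC addrC; apply: QS => //.
  by rewrite addr_ge0// mulr_ge0// ltW.
move=> t t0; set m := Num.truncn (t / p).
have /andP[m1 m2] : m%:R <= t / p < m.+1%:R by apply: truncn_itv; rewrite divr_ge0// ltW.
have -> : t = m%:R * p + (t - m%:R * p) by rewrite addrC subrK.
apply: H; rewrite subr_ge0 -ler_pdivlMr// m1/= lerBlDr.
by move: m2; rewrite ltr_pdivrMr// -natr1 mulrDl mul1r addrC => /ltW.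
Qed.

(** The Fourier coefficients of the convolution of [r] with [e^(-c v)] on the
    positive half-line, when [a] and [b] are those of [r]. *)
Definition convolution_cos c (a b : nat -> R) k : R :=
  (a k * c - b k * k%:R) / (k%:R ^+ 2 + c ^+ 2).
Definition convolution_sin c (a b : nat -> R) k : R :=
  (a k * k%:R + b k * c) / (k%:R ^+ 2 + c ^+ 2).

(** [Y] is the periodic solution of [Y' + c Y = r]. On the first period all
    claims come from the limit of the kernel; they propagate from [t] to
    [t + 2 pi] because the integral over [[0, t + 2 pi]] is the one over
    [[0, 2 pi]] plus [e^(2 pi c)] times the one over [[0, t]]. *)
Lemma fourier_convolution (r : R -> R) lambda a b c : 0 < c ->
  (forall u, 0 <= r u) -> locally_integrable setT r -> periodic r (pi *+ 2) ->
  fourier_coefficients r lambda a b ->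
  exists Y : R -> R,
  [/\ forall t, 0 <= t -> \sum_(1 <= k < N) (convolution_cos c a b k * cos (k%:R * t) +
         convolution_sin c a b k * sin (k%:R * t)) @[N --> \oo] --> Y t - lambda / c,
      forall t, 0 <= t -> cvgn (fun N => \sum_(1 <= k < N)
         (convolution_cos c a b k * cos (k%:R * (- t)) +
         convolution_sin c a b k * sin (k%:R * (- t)))) &
      forall t, 0 <= t -> Y t - expR (- (c * t)) * Y 0 =
         expR (- (c * t)) * \int[leb]_(u in `[0, t]) (r u * expR (c * u))].
Proof.
move=> c0 r0 rl rp [rlambda ra rb].
have pi0 : pi != 0 :> R by rewrite gt_eqF// pi_gt0.
have [s [s1 Ss]] := exp_kernel_cvg_normalised c0.
set p : R := pi *+ 2.
have p0 : 0 < p by rewrite mulrn_wgt0// pi_gt0.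
have intr := locally_integrable_itv 0 p rl.
pose W t N := \sum_(1 <= k < N) (convolution_cos c a b k * cos (k%:R * t) +
         convolution_sin c a b k * sin (k%:R * t)).
pose I t := \int[leb]_(u in `[0, t]) (r u * expR (c * u)).
pose L t := s * expR (- (c * t)) * (I t + expR (- (c * p)) * (I p - I t)) / p.
have WL t : 0 <= t <= p -> W t N @[N --> \oo] --> L t - lambda / c.
  move=> tp; have H := Rintegral_mul_exp_kernel_cvg c0 Ss intr tp.
  pose J N := \int[leb]_(u in `[0, pi *+ 2]) (r u * exp_kernel c N (t - u)).
  have WE N : W t N = J N / p - lambda / c.
    rewrite /J Rintegral_mul_exp_kernel//.
    have -> : \int[leb]_(u in `[0, pi *+ 2]) r u = p * lambda.
      by rewrite rlambda mulrA mulfV ?mul1r// gt_eqF.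
    set V := 2 * _; suff -> : V = p * W t N by field; rewrite (gt_eqF c0) /=; exact: pi0.
    rewrite /V /W !mulr_sumr; apply: eq_big_nat => k /andP[k0 _].
    have -> : \int[leb]_(u in `[0, pi *+ 2]) (r u * cos (k%:R * u)) = pi * a k.
      by rewrite ra// mulrA mulfV ?mul1r.
    have -> : \int[leb]_(u in `[0, pi *+ 2]) (r u * sin (k%:R * u)) = pi * b k.
      by rewrite rb// mulrA mulfV ?mul1r.
    rewrite /convolution_cos /convolution_sin /p; field.
    by rewrite gt_eqF// addr_gt0// ?exprn_gt0// ltr0n.
  rewrite (_ : W t = (fun N => J N / p - lambda / c)); last by apply/funext.
  by apply: cvgB; [apply: cvgMr_tmp|exact: cvg_cst].
have WD t N : W (p + t) N = W t N.
  apply: eq_bigr => k _; rewrite [p + t]addrC /p -[pi *+ 2]mulr1n.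
  by rewrite cos_natmulD2pi sin_natmulD2pi.
pose Y t := lambda / c + limn (W t).
have YL t : 0 <= t <= p -> Y t = L t.
  by move=> /WL /cvg_lim Wt; rewrite /Y Wt// addrC subrK.
have YD t : Y (p + t) = Y t.
  by rewrite /Y; congr (_ + limn _); apply/funext => N.
have q1 : expR (- (c * p)) * expR (c * p) = 1 by rewrite -expRD addNr expR0.
have I0 : I 0 = 0 by rewrite /I set_itv1 Rintegral_set1.
have YI t : 0 <= t <= p -> Y t - expR (- (c * t)) * Y 0 = expR (- (c * t)) * I t.
  have p00 : (0 : R) <= 0 <= p by rewrite lexx ltW.
  move=> tp; rewrite (YL _ tp) (YL _ p00) /L I0 mulr0 oppr0 expR0 mulr1 addr0 add0r.
  move: s1; rewrite -/p; set q := expR (- (c * p)) => s1.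
  rewrite (_ : _ - _ = s * (1 - q) / p * (expR (- (c * t)) * I t)); last first.
    by field; exact: pi0.
  by rewrite s1 mulfV ?mul1r// gt_eqF.
exists Y; split.
- suff H t : 0 <= t -> W t N @[N --> \oo] --> Y t - lambda / c by exact: H.
  move: t; apply: (periodic_ind p0) => [t tp|t _]; first by rewrite (YL _ tp); exact: WL.
  by rewrite YD (_ : W (p + t) = W t)//; apply/funext => N; exact: WD.
- suff H t : 0 <= t -> cvgn (W (- t)) by exact: H.
  move: t; apply: (periodic_ind p0) => [t /andP[t0 tp]|t _].
    have -> : W (- t) = W (p - t) by apply/funext => N; rewrite WD.
    by apply: cvgP; apply: WL; apply/andP; split; lra.
  have -> // : W (- t) = W (- (p + t)).
  by apply/funext => N; rewrite -(WD (- (p + t))); congr (W _ N); lra.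
- apply: (periodic_ind p0) => // t t0 IH; rewrite YD -/(I (p + t)).
  have Ip : I p = expR (c * p) * Y 0 - Y 0.
    have := YI p; rewrite lexx ltW// => /(_ isT).
    rewrite -[p in Y p]addr0 YD => E.
    have Qq : expR (c * p) * expR (- (c * p)) = 1 by rewrite mulrC.
    by rewrite -[LHS]mul1r -Qq -mulrA -E mulrBr mulrA Qq mul1r.
  have IpD : I (p + t) = I p + expR (c * p) * I t.
    have int x y : leb.-integrable `[x, y] (EFin \o (fun u => r u * expR (c * u))).
      by apply: integrable_mul_continuous; [exact: locally_integrable_itv|exact: continuous_expM].
    apply/eqP; rewrite [X in _ == X]addrC -subr_eq; apply/eqP.
    rewrite /I (Rintegral_itvB (x := p)) ?bnd_simp//; last 2 first.
      exact: ltW.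
      by rewrite lerDl.
    rewrite Rintegral_itv_obnd_cbnd; last first.
      by apply: integrableS (int p (p + t)) => //; exact: subset_itv_oc_cc.
    rewrite -[X in `[X, _]](addr0 p) ge0_Rintegral_translate.
    - rewrite -RintegralZl//; apply: eq_Rintegral => u _.
      by rewrite addrC rp mulrDr expRD; ring.
    - apply: measurable_funM; first by case: rl.
      by apply: continuous_measurable_fun; exact: continuous_expM.
    - by move=> u; rewrite mulr_ge0 ?expR_ge0.
  have -> : expR (- (c * (p + t))) = expR (- (c * p)) * expR (- (c * t)).
    by rewrite -expRD mulrDr opprD.
  rewrite IpD Ip.
  move: IH; rewrite -/(I t); set e := expR (- (c * t)).
  move: q1; set q := expR (- _); set Q := expR _ => qQ IH.
  rewrite [RHS](_ : _ = e * (q * Q) * I t + e * (q * Q) * Y 0 - q * e * Y 0); last by ring.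
  by rewrite qQ !mulr1 -IH; ring.
Qed.

End fourier_convolution.

Section fourier_series.
Context {R : realType}.
Notation leb := (@lebesgue_measure R).

(** The cosine and sine parts of the series of [Y] are separated by parity. *)
Lemma convolution_series (r : R -> R) lambda a b c t : 0 < c -> 0 <= t ->
  (forall u, 0 <= r u) -> locally_integrable setT r -> periodic r (pi *+ 2) ->
  fourier_coefficients r lambda a b ->
  exists lc ls : R,
  [/\ \sum_(1 <= k < N) convolution_cos c a b k * (cos (k%:R * t) - expR (- (c * t)))
        @[N --> \oo] --> lc,
      \sum_(1 <= k < N) convolution_sin c a b k * sin (k%:R * t) @[N --> \oo] --> ls &
      expR (- (c * t)) * \int[leb]_(u in `[0, t]) (r u * expR (c * u)) =
      lambda / c * (1 - expR (- (c * t))) + lc + ls].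
Proof.
move=> c0 t0 r0 rl rp rf.
have [Y [YW YN YI]] := fourier_convolution c0 r0 rl rp rf.
set W := fun t N => \sum_(1 <= k < N) (convolution_cos c a b k * cos (k%:R * t) +
         convolution_sin c a b k * sin (k%:R * t)).
have Wt : W t N @[N --> \oo] --> Y t - lambda / c by exact: YW.
have W0 : W 0 N @[N --> \oo] --> Y 0 - lambda / c by exact: YW.
have WN : W (- t) N @[N --> \oo] --> limn (W (- t)) by exact: (YN t t0).
set l' := limn _ in WN; set e := expR _.
exists (2^-1 * ((Y t - lambda / c) + l') - e * (Y 0 - lambda / c)),
  (2^-1 * ((Y t - lambda / c) - l')); split; last by rewrite -YI// -/e; lra.
- rewrite (_ : (fun N => _) = (fun N => 2^-1 * (W t N + W (- t) N) - e * W 0 N)).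
    by apply: cvgB; apply: cvgMl_tmp => //; exact: cvgD.
  apply/funext => N; rewrite /W -big_split/= !mulr_sumr -sumrB; apply: eq_bigr => k _.
  by rewrite mulr0 cos0 sin0 mulrN cosN sinN; lra.
- rewrite (_ : (fun N => _) = (fun N => 2^-1 * (W t N - W (- t) N))).
    by apply: cvgMl_tmp; exact: cvgB.
  apply/funext => N; rewrite /W -sumrB mulr_sumr; apply: eq_bigr => k _.
  by rewrite mulrN cosN sinN; lra.
Qed.

End fourier_series.

(** * Independence of discrete random variables *)

Section discrete_independence.
Local Open Scope ereal_scope.
Context d (T : measurableType d) (R : realType) (P : probability T R).

Lemma measurable_nat_fiber (N : T -> nat) (B : set nat) :
  measurable_fun setT N -> measurable (N @^-1` B).
Proof. by move=> mN; rewrite -[X in measurable X]setTI; exact: mN. Qed.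

Lemma measurable_fun_of_nat (N : T -> nat) (x : nat -> R) :
  measurable_fun setT N -> measurable_fun setT (fun w => x (N w)).
Proof. by move=> mN; apply: (measurableT_comp (f := x)). Qed.

Lemma ge0_integral_nat_fibers (D : set T) (N : T -> nat) (x : nat -> R) (h : T -> \bar R) :
  measurable D -> measurable_fun setT N -> (forall k, (0 <= x k)%R) ->
  measurable_fun D h -> (forall w, D w -> 0 <= h w) ->
  \int[P]_(w in D) ((x (N w))%:E * h w) =
  \sum_(k <oo) (x k)%:E * \int[P]_(w in D `&` N @^-1` [set k]) h w.
Proof.
move=> mD mN x0 mh h0.
have mF k : measurable (D `&` N @^-1` [set k]).
  by apply: measurableI => //; exact: measurable_nat_fiber.
have DF : D = \bigcup_k (D `&` N @^-1` [set k]).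
  apply/seteqP; split=> w; last by case=> k _ [].
  by move=> Dw; exists (N w).
pose f w := (x (N w))%:E * h w.
have mf : measurable_fun D f.
  apply: emeasurable_funM => //.
  by apply/measurable_EFinP; apply: measurable_funTS; exact: measurable_fun_of_nat.
have f0 w : D w -> 0 <= f w by move=> Dw; rewrite mule_ge0 ?lee_fin ?h0.
have tF : trivIset setT (fun k => D `&` N @^-1` [set k]).
  by move=> i j _ _ [w [[_ /= <-] [_ /= <-]]].
have := @ge0_integral_bigcup _ _ _ P _ f mF; rewrite -DF => /(_ mf f0 tF) ->.
apply: eq_eseriesr => k _; rewrite -ge0_integralZl//.
- by apply: eq_integral => w; rewrite inE => -[_ /= <-].
- by apply: measurable_funS mh => //; exact: subIsetl.
- by move=> w [Dw _]; exact: h0.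
- by rewrite lee_fin.
Qed.

Context (I : choiceType) (G : I -> set_system T).

Lemma mutually_independent_seq (s : seq I) (E : I -> set T) :
  mutually_independent P G -> uniq s -> (forall i, i \in s -> G i (E i)) ->
  P (\bigcap_(i in [set` s]) E i) = \prod_(i <- s) P (E i).
Proof.
move=> indep us GE.
transitivity (\prod_(i <- [fset i in s]%fset) P (E i)); last first.
  by apply: perm_big; apply: uniq_perm => // i; rewrite inE.
rewrite -(indep [fset i in s]%fset E); last by move=> i; rewrite inE; exact: GE.
rewrite (_ : [set` s] = [set` [fset i in s]%fset])//.
by apply/seteqP; split=> i /=; rewrite inE.
Qed.

(** The events [E i] are there for the induction on [s1]: splitting along the
    values of one variable turns it into one more event. *)
Lemma integral_prod_independent (N : I -> T -> nat) (x : I -> nat -> R) s1 s2 (E : I -> set T) :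
  mutually_independent P G -> uniq (s1 ++ s2) ->
  (forall i, i \in s1 -> measurable_fun setT (N i)) ->
  (forall i k, i \in s1 -> G i (N i @^-1` [set k])) ->
  (forall i k, (0 <= x i k)%R) ->
  (forall i, i \in s1 -> \int[P]_w (x i (N i w))%:E \is a fin_num) ->
  (forall i, i \in s2 -> measurable (E i)) ->
  (forall i, i \in s2 -> G i (E i)) ->
  \int[P]_(w in \bigcap_(i in [set` s2]) E i) (\prod_(i <- s1) x i (N i w))%:E =
  (\prod_(i <- s1) \int[P]_w (x i (N i w))%:E) * \prod_(i <- s2) P (E i).
Proof.
move=> indep; elim: s1 s2 E => [|i s1 IH] s2 E us mN GN x0 fx mE GE.
  under eq_integral do rewrite big_nil.
  rewrite big_nil mul1e integral_cst//= ?mul1e; first exact: mutually_independent_seq.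
  by apply: fin_bigcap_measurable => //; exact: mE.
have mN1 j : j \in s1 -> measurable_fun setT (N j).
  by move=> js; apply: mN; rewrite inE js orbT.
have mNi : measurable_fun setT (N i) by apply: mN; rewrite inE eqxx.
under eq_integral do rewrite big_cons EFinM.
rewrite ge0_integral_nat_fibers//; last 3 first.
- by apply: fin_bigcap_measurable => //; exact: mE.
- apply/measurable_EFinP; apply: measurable_funTS.
  by apply: measurable_prod => j js; exact/measurable_fun_of_nat/mN1.
- by move=> w _; rewrite lee_fin prodr_ge0.
move: us; rewrite /= mem_cat negb_or => /andP[/andP[is1 is2] us].
pose E' k j := if j == i then N i @^-1` [set k] else E j.
have E's2 k j : j \in s2 -> E' k j = E j.
  by move=> js2; rewrite /E'; case: eqVneq => // ji; rewrite ji (negPf is2) in js2.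
have step k : \int[P]_(w in \bigcap_(i in [set` s2]) E i `&` N i @^-1` [set k])
    (\prod_(j <- s1) x j (N j w))%:E =
  (\prod_(i <- s1) \int[P]_w (x i (N i w))%:E) *
     (P (N i @^-1` [set k]) * \prod_(i <- s2) P (E i)).
  rewrite (_ : _ `&` _ = \bigcap_(j in [set` i :: s2]) E' k j); last first.
    apply/seteqP; split=> w.
      move=> [Dw Nw] j /=; rewrite inE => /predU1P[->|js]; first by rewrite /E' eqxx.
      by rewrite E's2//; exact: Dw.
    move=> H; split=> [j /= js|].
      by rewrite -(E's2 k j js); apply: H; rewrite /= inE js orbT.
    by have := H i; rewrite /= inE eqxx /E' eqxx; exact.
  rewrite IH//.
  - rewrite big_cons {1}/E' eqxx; congr (_ * (_ * _)).
    by apply: eq_big_seq => j js; rewrite E's2.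
  - by rewrite -cat1s uniq_catCA /= mem_cat negb_or is1 is2.
  - by move=> j l js; apply: GN; rewrite inE js orbT.
  - by move=> j js; apply: fx; rewrite inE js orbT.
  - move=> j; rewrite inE => /orP[/eqP ->|js]; last by rewrite E's2//; exact: mE.
    by rewrite /E' eqxx; exact: measurable_nat_fiber.
  - move=> j; rewrite inE => /orP[/eqP ->|js]; last by rewrite E's2//; exact: GE.
    by rewrite /E' eqxx; apply: GN; rewrite inE eqxx.
under eq_eseriesr do rewrite step.
rewrite big_cons.
have -> : \int[P]_w (x i (N i w))%:E = \sum_(k <oo) (x i k)%:E * P (N i @^-1` [set k]).
  rewrite -[LHS](_ : \int[P]_w ((x i (N i w))%:E * cst 1 w) = _); last first.
    by apply: eq_integral => w _; rewrite mule1.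
  rewrite ge0_integral_nat_fibers//; apply: eq_eseriesr => k _.
  rewrite setTI integral_cst//= ?mul1e//; exact: measurable_nat_fiber.
set A := \prod_(i <- s1) _; set B := \prod_(i <- s2) _.
have fA : A \is a fin_num.
  rewrite /A big_seq; apply: prode_fin_num => j js.
  by apply: fx; rewrite inE js orbT.
have fB : B \is a fin_num.
  by rewrite /B big_seq; apply: prode_fin_num => j js; rewrite fin_num_measure//; exact: mE.
rewrite -muleA [RHS]muleC -(fineK (_ : A * B \is a fin_num)) ?fin_numM//.
rewrite -nneseriesZl; last by move=> k _; rewrite mule_ge0// lee_fin.
apply: eq_eseriesr => k _; rewrite fineK ?fin_numM//.
by rewrite [A * (_ * B)]muleCA [RHS]muleC -muleA.
Qed.

End discrete_independence.

Section counting.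
Context d (T : measurableType d).

Lemma measurable_fun_nat_fibers (N : T -> nat) :
  (forall k, measurable (N @^-1` [set k])) -> measurable_fun setT N.
Proof.
move=> mN _ B _; rewrite setTI (_ : _ @^-1` B = \bigcup_(k in B) N @^-1` [set k]).
  by apply: bigcup_measurable => k _; exact: mN.
by apply/seteqP; split=> w /=; [move=> BN; exists (N w)|case=> k Bk /= ->].
Qed.

(** A countable type has countably many finite subsets [F], and [X w = F] is a
    countable conjunction. On the event that [X w] is infinite the cardinal
    takes its default value [0]. *)
Lemma measurable_card_fset_set (I : countType) (X : T -> set I) :
  (forall i, measurable [set w | X w i]) ->
  measurable_fun setT (fun w => #|` fset_set (X w)|).
Proof.
move=> mX.
have mI (F : {fset I}) : measurable [set w | X w = [set` F]].
  rewrite (_ : [set _ | _] =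
    ~` \bigcup_i (if i \in F then ~` [set w | X w i] else [set w | X w i])).
    apply: measurableC; apply: countable_bigcupT_measurable => [|i]; first exact: countableP.
    by case: ifP => _ //; apply: measurableC.
  apply/seteqP; split=> w /=.
    by move=> XF [i _]; case: ifPn => iF /=; rewrite XF/=; [move=> /(_ iF)|exact/negP].
  move=> H; apply/seteqP; split=> i.
    move=> Xi /=; apply: contrapT => /negP iF; apply: H.
    by exists i => //; rewrite (negPf iF).
  by move=> /= iF; apply: contrapT => Xi; apply: H; exists i => //; rewrite iF.
have mfin k : measurable (\bigcup_(F : {fset I})
    if #|` F| == k then [set w | X w = [set` F]] else set0).
  apply: countable_bigcupT_measurable => [|F]; first exact: countableP.
  by case: ifP.
have minf : measurable [set w | ~ finite_set (X w)].
  rewrite (_ : [set _ | _] = ~` \bigcup_(F : {fset I}) [set w | X w = [set` F]]).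
    apply: measurableC; apply: countable_bigcupT_measurable => [|F//]; exact: countableP.
  apply/seteqP; split=> w /=.
    by move=> Xw [F _] /= XF; apply: Xw; rewrite XF; exact: finite_fset.
  by move=> H Xw; apply: H; exists (fset_set (X w)) => //=; rewrite fset_setK.
apply: measurable_fun_nat_fibers => k.
rewrite (_ : _ @^-1` _ = (\bigcup_(F : {fset I})
    if #|` F| == k then [set w | X w = [set` F]] else set0)
    `|` (if k == 0%N then [set w | ~ finite_set (X w)] else set0)).
  by apply: measurableU => //; case: ifP.
apply/seteqP; split=> w /=.
  have [Xw|Xw] := pselect (finite_set (X w)).
    by move=> <-; left; exists (fset_set (X w)) => //=; rewrite eqxx/= fset_setK.
  by rewrite /fset_set; case: pselect => // _ <-; right; rewrite cardfs0 eqxx.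
case=> [[F _]|]; first by case: eqP => //= <- ->; rewrite set_fsetK.
by case: eqP => //= -> Xw; rewrite /fset_set; case: pselect => // _; rewrite cardfs0.
Qed.

End counting.

(** * Poisson counts and exponential tails *)

Section poisson_pgf.
Context d (T : measurableType d) (R : realType) (P : probability T R).
Notation leb := (@lebesgue_measure R).

Lemma nneseries_exp_coeff (y : R) :
  (\sum_(k <oo) (y ^+ k / k`!%:R)%:E = (expR y)%:E)%E.
Proof.
rewrite -EFin_lim; last exact: is_cvg_series_exp_coeff.
by apply/congr_lim/funext => n /=; rewrite sumEFin.
Qed.

Lemma measurable_itv_fiber (X : {RV P >-> R}) (i : interval R) :
  measurable (X @^-1` [set` i]).
Proof. by rewrite -[X in measurable X]setTI; exact: measurable_funP. Qed.

Lemma measurable_arrivals (A : nat -> {RV P >-> R}) s t :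
  measurable_fun setT (arrivals A s t).
Proof.
apply: (@measurable_card_fset_set _ _ nat (fun w => [set i | s < A i w <= t])) => i.
rewrite (_ : [set _ | _] = A i @^-1` `]s, t]); first exact: measurable_itv_fiber.
by apply/seteqP; split=> w /=; rewrite in_itv.
Qed.

Lemma arrivals_itvxx (A : nat -> T -> R) s w : arrivals A s s w = 0%N.
Proof.
rewrite /arrivals (_ : [set _ | _] = set0) ?fset_set0 ?cardfs0//.
by apply/seteqP; split=> i //= /andP[si si']; move: (lt_le_trans si si'); rewrite ltxx.
Qed.

(** [poisson_pmf] is constantly [1] at rate [0], which cannot be the law of a
    random variable. *)
Lemma poisson_rate_gt0 (r : R -> R) (A : nat -> {RV P >-> R}) s t :
  poisson_epochs r A -> 0 <= s -> s < t ->
  0 < \int[leb]_(u in `]s, t]) r u.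
Proof.
move=> pA s0 st; rewrite ltNge; apply/negP => L0.
have pk k : P (arrivals A s t @^-1` [set k]) = 1%E.
  by rewrite (poisson_increments pA)// /poisson_pmf ltNge L0.
have mk k : measurable (arrivals A s t @^-1` [set k]).
  by apply: measurable_nat_fiber; exact: measurable_arrivals.
have PU : (P (arrivals A s t @^-1` [set 0%N] `|` arrivals A s t @^-1` [set 1%N]) = 1 + 1)%E.
  rewrite measureU//; last by apply/seteqP; split=> w //= [->].
  by congr (_ + _)%E; exact: pk.
have : (P (arrivals A s t @^-1` [set 0%N] `|` arrivals A s t @^-1` [set 1%N]) <= 1)%E.
  by apply: probability_le1; exact: measurableU.
by rewrite PU -EFinD lee_fin; lra.
Qed.

Lemma arrivals_pgf (r : R -> R) (A : nat -> {RV P >-> R}) s t x :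
  poisson_epochs r A -> 0 <= s -> s <= t -> 0 <= x ->
  (\int[P]_w (x ^+ arrivals A s t w)%:E)%E =
  (expR ((x - 1) * \int[leb]_(u in `]s, t]) r u))%:E.
Proof.
move=> pA s0; rewrite le_eqVlt => /orP[/eqP <- x0|st x0].
  under eq_integral do rewrite arrivals_itvxx expr0.
  rewrite integral_cst//= mul1e set_itvoc0 Rintegral_set0 mulr0 expR0.
  exact: probability_setT.
have L0 := poisson_rate_gt0 pA s0 st.
set L := Rintegral _ _ _ in L0 *.
have mN := measurable_arrivals A s t.
rewrite (_ : (fun w => _) = (fun w => (GRing.exp x (arrivals A s t w))%:E * cst 1 w)%E); last first.
  by apply/funext => w; rewrite mule1.
rewrite ge0_integral_nat_fibers//; last by move=> k; exact: exprn_ge0.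
under eq_eseriesr => k _.
  rewrite setTI integral_cst//=; last exact: measurable_nat_fiber.
  rewrite mul1e (poisson_increments pA k s0 st) -/L /poisson_pmf L0 -EFinM.
  rewrite (_ : x ^+ k * _ = expR (- L) * ((x * L) ^+ k / k`!%:R)); last by rewrite exprMn; ring.
  rewrite EFinM; over.
rewrite nneseriesZl; last by move=> k _; rewrite lee_fin divr_ge0// exprn_ge0// mulr_ge0// ltW.
by rewrite nneseries_exp_coeff -EFinM -expRD; congr (expR _)%:E; ring.
Qed.

End poisson_pgf.

Section exponential_tail.
Context (R : realType).

Lemma exponential_prob_tail (mu v : R) : 0 < mu -> 0 <= v ->
  exponential_prob mu `]v, +oo[%classic = (expR (- (mu * v)))%:E.
Proof.
move=> mu0 v0; rewrite /exponential_prob integral_itv_obnd_cbnd; last first.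
  apply: measurable_funTS; apply/measurable_EFinP; exact: measurable_exponential_pdf.
rewrite (@ge0_continuous_FTC2y _ _ (fun x => - expR (- mu * x)) _ 0)//.
- by rewrite -EFinB sub0r opprK mulNr.
- by move=> x _; apply: exponential_pdf_ge0; exact: ltW.
- apply: (@continuous_subspaceW R^o _ _ [set` `[0, +oo[%R]).
    by apply: subset_itvr; rewrite bnd_simp.
  exact: within_continuous_exponential_pdf.
- rewrite -oppr0; apply: cvgN.
  rewrite (_ : (fun x => expR (- mu * x)) =
               (fun z => expR (- z)) \o (fun z => mu * z)); last first.
    by apply: eq_fun => x; rewrite mulNr.
  apply: (@cvg_comp _ _ _ _ _ _ (pinfty_nbhs R)); last exact: cvgr_expR.
  exact: gt0_cvgMry.
- by apply: cvgN; apply/cvg_at_right_filter; exact: continuous_expM.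
- move=> x; rewrite in_itv/= andbT => vx; apply: derive1_exponential_pdf.
  by rewrite in_itv/= andbT (le_lt_trans v0).
Qed.

Context d (T : measurableType d) (P : probability T R).

Lemma expectation_if_tail (X : {RV P >-> R}) (mu v z : R) :
  0 < mu -> 0 <= v -> -1 <= z ->
  (forall V, measurable V -> distribution P X V = exponential_prob mu V) ->
  (\int[P]_w (if (v < X w)%R : nat is 0%N then 1 else 1 + z)%:E =
   (1 + z * expR (- (mu * v)))%:E)%E.
Proof.
move=> mu0 v0 z1 PX.
have mB : measurable (X @^-1` `]v, +oo[) by exact: measurable_itv_fiber.
have PB : P (X @^-1` `]v, +oo[) = (expR (- (mu * v)))%:E.
  by rewrite -exponential_prob_tail// -PX.
rewrite (_ : (fun w => _) = fun w => ((\1_(~` (X @^-1` `]v, +oo[)) w)%:E +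
    (1 + z)%:E * (\1_(X @^-1` `]v, +oo[) w)%:E)%E); last first.
  apply/funext => w; rewrite -EFinM -EFinD !indicE in_setC; congr (_%:E).
  have -> : (w \in X @^-1` `]v, +oo[) = (v < X w).
    by apply/idP/idP; rewrite inE/= in_itv/= andbT.
  by case: (v < X w) => /=; lra.
have z10 : (0 <= (1 + z)%:E)%E by rewrite lee_fin; lra.
have mBC := measurableC mB.
rewrite ge0_integralD//; last 3 first.
- by apply/measurable_EFinP.
- by move=> w _; rewrite mule_ge0// lee_fin.
- by apply: measurable_funeM; apply/measurable_EFinP.
rewrite ge0_integralZl//; last by apply/measurable_EFinP.
rewrite !integral_indic// !setIT.
transitivity ((1 - (expR (- (mu * v)))%:E) + (1 + z)%:E * (expR (- (mu * v)))%:E)%E.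
  by congr (_ + _ * _)%E; [rewrite -PB; exact: probability_setC|exact: PB].
by rewrite -EFinB -EFinM -EFinD; congr (_%:E); ring.
Qed.

End exponential_tail.

(** * Cells of arrival epochs *)

Section cells.
Context d (T : measurableType d) (R : realType) (P : probability T R).
Context (A : nat -> {RV P >-> R}) (t : R) (m : nat).
Implicit Types (w : T) (s : seq 'I_m.+1).

Definition grid (p : nat) : R := p%:R * (t / m.+1%:R).

(** The first epochs lie in the cells listed by [s], and the next one is
    after [t]. *)
Definition cell_event s : set T := [set w |
  (forall i, (i < size s)%N -> grid (nth ord0 s i) < A i w <= grid (nth ord0 s i).+1) /\
  t < A (size s) w].

Definition regular_epochs w :=
  [/\ 0 < A 0 w, forall i, A i w < A i.+1 w & A ^~ w @ \oo --> +oo].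

Lemma grid_le p q : 0 <= t -> (p <= q)%N -> grid p <= grid q.
Proof. by move=> t0 pq; rewrite /grid ler_wpM2r ?ler_nat// divr_ge0. Qed.

Lemma grid0 : grid 0 = 0. Proof. by rewrite /grid mul0r. Qed.

Lemma grid_last : grid m.+1 = t.
Proof. by rewrite /grid mulrCA mulfV ?mulr1. Qed.

Lemma grid_ge0 p : 0 <= t -> 0 <= grid p.
Proof. by move=> t0; rewrite -grid0 grid_le. Qed.

Lemma grid_le_t p : 0 <= t -> (p <= m.+1)%N -> grid p <= t.
Proof. by move=> t0 pm; rewrite -[leRHS]grid_last grid_le. Qed.

Lemma cell_uniq p q x : 0 <= t -> grid p < x <= grid p.+1 -> grid q < x <= grid q.+1 -> p = q.
Proof.
move=> t0; wlog pq : p q / (p <= q)%N.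
  by move=> H Hp Hq; have [pq|/ltnW qp] := leqP p q; [exact: H|apply/esym; exact: H].
move=> /andP[p1 p2] /andP[q1 q2]; apply/eqP; rewrite eqn_leq pq/= leqNgt; apply/negP => pltq.
by have := lt_le_trans q1 (le_trans p2 (grid_le t0 pltq)); rewrite ltxx.
Qed.

Lemma cell_exists x : 0 < x <= t -> exists p : 'I_m.+1, grid p < x <= grid p.+1.
Proof.
move=> /andP[x0 xt].
have ex : exists p, x <= grid p.+1 by exists m; rewrite grid_last.
case: (ex_minnP ex) => p xp pmin.
have pm : (p < m.+1)%N by rewrite ltnS pmin// grid_last.
exists (Ordinal pm); rewrite xp andbT /=.
case: p xp pmin pm => [|p] xp pmin pm; first by rewrite grid0.
by rewrite ltNge; apply/negP => /pmin; rewrite ltnn.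
Qed.

Lemma measurable_cell_event s : measurable (cell_event s).
Proof.
rewrite (_ : cell_event s = \bigcap_(i in `I_(size s))
     A i @^-1` `](grid (nth ord0 s i)), (grid (nth ord0 s i).+1)]
    `&` A (size s) @^-1` `]t, +oo[).
  apply: measurableI; last exact: measurable_itv_fiber.
  by apply: bigcap_measurableType => i _; exact: measurable_itv_fiber.
apply/seteqP; split=> w /=; rewrite !in_itv/= andbT.
  by move=> [H1 H2]; split => // i /= si; rewrite in_itv/= H1.
by move=> [H1 H2]; split=> // i si; have := H1 i si; rewrite /= in_itv.
Qed.

Lemma cell_event_sigma s :
  <<s \bigcup_i g_sigma_algebra_preimage (A i) >> (cell_event s).
Proof.
set G := (X in <<s X >>).
have AG i (j : interval R) : <<s G >> (A i @^-1` [set` j]).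
  apply: sub_gen_smallest; exists i => //; exists [set` j] => //.
  by rewrite setTI.
rewrite (_ : cell_event s = \bigcap_(i in `I_(size s))
     A i @^-1` `](grid (nth ord0 s i)), (grid (nth ord0 s i).+1)]
    `&` A (size s) @^-1` `]t, +oo[).
  have mI := @measurableI _ (g_sigma_algebraType G).
  apply: mI; last exact: AG.
  have mcap := @bigcap_measurableType _ (g_sigma_algebraType G).
  by apply: mcap => i _; exact: AG.
apply/seteqP; split=> w /=; rewrite !in_itv/= andbT.
  by move=> [H1 H2]; split => // i /= si; rewrite in_itv/= H1.
by move=> [H1 H2]; split=> // i si; have := H1 i si; rewrite /= in_itv.
Qed.

Lemma cell_event_inj s1 s2 w : 0 <= t -> cell_event s1 w -> cell_event s2 w -> s1 = s2.
Proof.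
move=> t0.
have szle s s' : cell_event s w -> cell_event s' w -> (size s <= size s')%N.
  move=> [H _] [_ L]; rewrite leqNgt; apply/negP => sz.
  have /andP[_ Ag] := H _ sz.
  have := lt_le_trans L (le_trans Ag (grid_le_t t0 (ltn_ord (nth ord0 s (size s'))))).
  by rewrite ltxx.
move=> e1 e2; have sz : size s1 = size s2 by apply/eqP; rewrite eqn_leq !szle.
case: e1 e2 => H1 _ [H2 _].
apply: (@eq_from_nth _ ord0) => // i si; apply/val_inj.
by apply: (cell_uniq t0 (H1 i si)); apply: H2; rewrite -sz.
Qed.

Lemma cell_event_exists w : regular_epochs w -> exists s, cell_event s w.
Proof.
move=> [A0 Alt Ay].
have ex : exists i, t < A i w.
  have /cvgryPgt/(_ t)[i _ H] := Ay.
  by exists i; apply: H => /=.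
case: (ex_minnP ex) => N tN Nmin.
have Apos i : 0 < A i w by elim: i => // i; move/lt_trans; apply.
have cell i : (i < N)%N -> exists p : 'I_m.+1, grid p < A i w <= grid p.+1.
  move=> iN; apply: cell_exists; rewrite Apos/= leNgt.
  by apply/negP => /Nmin; rewrite leqNgt iN.
have [f Hf] : exists f : nat -> 'I_m.+1, forall i, (i < N)%N -> grid (f i) < A i w <= grid (f i).+1.
  have cell' i : exists p : 'I_m.+1, (i < N)%N -> grid p < A i w <= grid p.+1.
    have [/cell[p Hp]|_] := boolP (i < N)%N; by [exists p|exists ord0].
  by have [f Hf] := choice cell'; exists f.
exists (mkseq f N); split; rewrite size_mkseq// => i iN.
by rewrite nth_mkseq//; exact: Hf.
Qed.

End cells.

Section paths.
Context d (T : measurableType d) (R : realType) (P : probability T R).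
Context (A : nat -> {RV P >-> R}) (t : R) (m : nat).
Implicit Types (w : T) (s : seq 'I_m.+1).

Lemma card_fset_set_seq (I : choiceType) (l : seq I) :
  uniq l -> #|` fset_set [set` l]| = size l.
Proof.
move=> ul; rewrite (_ : [set` l] = [set` [fset x in l]%fset]).
  by rewrite set_fsetK card_fseq undup_id.
by apply/seteqP; split=> i /=; rewrite inE.
Qed.

Lemma arrivals_cell w s (p : 'I_m.+1) : 0 <= t -> regular_epochs A w ->
  cell_event A t s w -> arrivals A (grid t m p) (grid t m p.+1) w = count_mem p s.
Proof.
move=> t0 [_ Alt _] [H L].
have Ale i j : (i <= j)%N -> A i w <= A j w.
  by move=> /subnK <-; elim: (j - i)%N => // k; rewrite addSn; move=> /le_trans; apply; exact: ltW.
rewrite -[in RHS](mkseq_nth ord0 s) /mkseq count_map -size_filter -card_fset_set_seq; last first.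
  by rewrite filter_uniq// iota_uniq.
congr (#|` fset_set _|); apply/seteqP; split=> i /=; rewrite mem_filter mem_iota/= add0n.
  move=> Hi.
  have si : (i < size s)%N.
    rewrite ltnNge; apply/negP => /Ale sA; move: Hi => /andP[_ Ai].
    have := lt_le_trans L (le_trans sA (le_trans Ai (grid_le_t t0 (ltn_ord p)))).
    by rewrite ltxx.
  by rewrite si andbT; apply/eqP/val_inj; exact: cell_uniq t0 (H i si) Hi.
by move=> /andP[/eqP <- si]; exact: H.
Qed.

Lemma prod_count_mem (g : 'I_m.+1 -> R) s :
  \prod_(p <- enum 'I_m.+1) g p ^+ count_mem p s = \prod_(x <- s) g x.
Proof.
elim: s => [|x s IH]; first by rewrite big_nil big1.
rewrite big_cons -IH; under eq_bigr do rewrite /= exprD.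
rewrite big_split/=; congr (_ * _).
rewrite big_enum/= (bigD1 x)//= eqxx expr1 big1 ?mulr1// => i ix.
by rewrite eq_sym (negPf ix) expr0.
Qed.

Context (Q0 n : nat) (S : customer Q0 n -> {RV P >-> R}).

(** The customers who can be present at time [t] when exactly [k] batches
    have arrived. *)
Definition customers_upto (k : nat) : seq (customer Q0 n) :=
  [seq inl j | j <- enum 'I_Q0] ++
  [seq inr (i, l) | i <- iota 0 k, l <- enum 'I_n].

Definition in_system (c : customer Q0 n) w :=
  arrival_time A c w <= t < arrival_time A c w + S c w.

Lemma uniq_customers_upto k : uniq (customers_upto k).
Proof.
rewrite cat_uniq; apply/and3P; split.
- by rewrite map_inj_uniq ?enum_uniq// => ? ? [].
- by apply/hasPn => _ /allpairsP[[i l] [_ _ ->]] /=; apply/mapP => -[].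
- by rewrite allpairs_uniq ?iota_uniq ?enum_uniq// => -[? ?] [? ?] _ _ [-> ->].
Qed.

Lemma mem_customers_upto k (c : customer Q0 n) :
  (c \in customers_upto k) = match c with inl _ => true | inr (i, _) => (i < k)%N end.
Proof.
rewrite mem_cat; case: c => [j|[i l]].
  by rewrite map_f// mem_enum.
rewrite [X in X || _](_ : _ = false)/=; last by apply/negbTE/negP => /mapP[].
apply/allpairsP/idP => [[[i' l'] /= [ik _ [-> _]]]|ik].
  by rewrite mem_iota add0n in ik.
by exists (i, l); split; rewrite ?mem_iota ?mem_enum.
Qed.

Lemma number_in_system_cell w s : 0 <= t -> regular_epochs A w ->
  cell_event A t s w ->
  number_in_system A S t w = count (in_system ^~ w) (customers_upto (size s)).
Proof.
move=> t0 [_ Alt _] [H L].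
have Ale i j : (i <= j)%N -> A i w <= A j w.
  by move=> /subnK <-; elim: (j - i)%N => // k; rewrite addSn; move=> /le_trans; apply; exact: ltW.
rewrite -size_filter -card_fset_set_seq; last by rewrite filter_uniq ?uniq_customers_upto.
congr (#|` fset_set _|); apply/seteqP; split=> c /=; rewrite mem_filter.
  move=> Hc; rewrite mem_customers_upto /in_system Hc/=.
  case: c Hc => // -[i l] /andP[/= Ai _]; rewrite ltnNge; apply/negP => /Ale sA.
  by have := lt_le_trans L (le_trans sA Ai); rewrite ltxx.
by move=> /andP[].
Qed.

End paths.

(** * Bounds for the generating function *)

Section sandwich.
Context d (T : measurableType d) (R : realType) (P : probability T R).
Notation leb := (@lebesgue_measure R).

Lemma ge0_integral_ae_partition (F : nat -> set T) (f : T -> \bar R) :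
  (forall k, measurable (F k)) -> trivIset setT F ->
  {ae P, forall w, exists k, F k w} ->
  measurable_fun setT f -> (forall w, (0 <= f w)%E) ->
  (\int[P]_w f w = \sum_(k <oo) \int[P]_(w in F k) f w)%E.
Proof.
move=> mF tF aeF mf f0.
have mU : measurable (\bigcup_k F k) by exact: bigcupT_measurable.
rewrite -ge0_integral_bigcup//; last exact: measurable_funTS.
rewrite [RHS]integral_mkcond; apply: ge0_ae_eq_integral => //.
- by apply/measurable_restrict => //; exact: measurable_funTS.
- by move=> w _; rewrite patchE; case: ifP.
- apply: filterS aeF => w [k Fkw] _; rewrite patchE ifT// inE.
  by exists k.
Qed.

Lemma preimage_tail_sigma (X : {RV P >-> R}) v k :
  g_sigma_algebra_preimage X ((fun w => (v < X w)%R : nat) @^-1` [set k]).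
Proof.
exists ((fun x => (v < x)%R : nat) @^-1` [set k]); last by rewrite setTI.
case: k => [|[|k]].
- rewrite (_ : _ @^-1` _ = `]-oo, v]%classic)//.
  by apply/seteqP; split=> x /=; rewrite in_itv/= leNgt; case: ltP.
- rewrite (_ : _ @^-1` _ = `]v, +oo[%classic)//.
  by apply/seteqP; split=> x /=; rewrite in_itv/= andbT; case: ltP.
- rewrite (_ : _ @^-1` _ = set0)//.
  by apply/seteqP; split=> x //=; case: ltP.
Qed.

Lemma measurable_tail (X : {RV P >-> R}) v :
  measurable_fun setT (fun w => (v < X w)%R : nat).
Proof.
apply: measurable_fun_nat_fibers => k.
have [B mB <-] := preimage_tail_sigma X v k.
exact: measurable_funP.
Qed.

Context (A : nat -> {RV P >-> R}) (t : R) (m : nat).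
Context (Q0 n : nat) (S : customer Q0 n -> {RV P >-> R}).
Context (mu z : R).
Implicit Types (w : T) (s : seq 'I_m.+1) (e : bool).

(** The sojourn that a customer must exceed in order to be present at time [t],
    once each arrival is moved to the left ([e = false]) or to the right
    ([e = true]) end of its cell. *)
Definition threshold e s (c : customer Q0 n) : R :=
  match c with inl _ => t | inr (i, _) => t - grid t m (nth ord0 s i + e) end.

(** The contribution of a customer to the product, according to whether the
    customer is absent ([0]) or present. *)
Definition presence_factor (k : nat) : R := if k is 0%N then 1 else 1 + z.

Definition shifted_product e s w : R :=
  \prod_(c <- customers_upto Q0 n (size s)) presence_factor (threshold e s c < S c w)%R.

(** The conditional expectation of the product over the members of one batch,
    when it arrives at that end of the cell [p]. *)
Definition cell_weight e (p : 'I_m.+1) : R :=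
  (1 + z * expR (- (mu * (t - grid t m (p + e))))) ^+ n.

Context (t0 : 0 <= t) (mu0 : 0 < mu) (z1 : -1 <= z).

Lemma presence_factor_ge0 k : 0 <= presence_factor k.
Proof. by case: k => //= k; rewrite -lerBlDl sub0r. Qed.

Lemma threshold_ge0 e s c : 0 <= threshold e s c.
Proof.
case: c => [//|[i l]] /=; rewrite subr_ge0 grid_le_t//.
by case: e; rewrite ?addn1 ?addn0// ltnW.
Qed.

Lemma tail_factor_ge0 v : 0 <= v -> 0 <= 1 + z * expR (- (mu * v)).
Proof.
move=> v0; have : expR (- (mu * v)) <= 1.
  by rewrite -expR0 ler_expR oppr_le0 mulr_ge0// ltW.
set E := expR _ => E1; have E0 : 0 <= E by exact: expR_ge0.
have : 0 <= (z + 1) * E by rewrite mulr_ge0// -lerBlDr sub0r.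
lra.
Qed.

Lemma cell_weight_ge0 e p : 0 <= cell_weight e p.
Proof.
apply/exprn_ge0/tail_factor_ge0; rewrite subr_ge0 grid_le_t//.
by case: e; rewrite ?addn1 ?addn0// ltnW.
Qed.

Lemma shifted_product_ge0 e s w : 0 <= shifted_product e s w.
Proof. by apply: prodr_ge0 => c _; exact: presence_factor_ge0. Qed.

Lemma prod_threshold e s :
  \prod_(c <- customers_upto Q0 n (size s)) (1 + z * expR (- (mu * threshold e s c))) =
  (1 + z * expR (- (mu * t))) ^+ Q0 * \prod_(x <- s) cell_weight e x.
Proof.
rewrite big_cat big_map; congr (_ * _).
  by rewrite big_enum/= prodr_const card_ord.
rewrite big_allpairs_dep (big_nth ord0)/= /index_iota subn0; apply: eq_bigr => i _.
by rewrite big_enum/= prodr_const card_ord.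
Qed.

Lemma measurable_shifted_product e s : measurable_fun setT (shifted_product e s).
Proof.
apply: measurable_prod => c _; apply: (measurable_fun_of_nat presence_factor).
exact: measurable_tail.
Qed.

Context (r : R -> R) (queue : infinite_server_queue r mu A S).

Let pA : poisson_epochs r A := poisson_arrivals queue.

(** Once the arrivals are moved to the grid, presence depends on the service
    times only, and these are independent of the epochs. *)
Lemma integral_shifted_product e s :
  (\int[P]_(w in cell_event A t s) (shifted_product e s w)%:E =
   ((1 + z * expR (- (mu * t))) ^+ Q0 * \prod_(x <- s) cell_weight e x)%:E *
   P (cell_event A t s))%E.
Proof.
pose N (o : option (customer Q0 n)) w : nat :=
  if o is Some c then (threshold e s c < S c w)%R else 0%N.
set cs := customers_upto Q0 n (size s).
have Ex c : (\int[P]_w (presence_factor (N (Some c) w))%:E =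
    (1 + z * expR (- (mu * threshold e s c)))%:E)%E.
  apply: expectation_if_tail => //; first exact: threshold_ge0.
  exact: exponential_services queue c.
have := @integral_prod_independent _ _ _ P (option (customer Q0 n) : choiceType) _ N
  (fun=> presence_factor) (map Some cs) [:: None] (fun=> cell_event A t s)
  (independent_primitives queue).
rewrite big_seq1 (_ : \bigcap_(i in _) _ = cell_event A t s); last first.
  by apply/seteqP; split=> [w H|w H i _//]; apply: (H None); rewrite /= inE.
have uSc : uniq (map Some cs ++ [:: None]).
  rewrite cat_uniq/= map_inj_uniq ?uniq_customers_upto/=; last by move=> ? ? [].
  by rewrite orbF andbT; apply/negP => /mapP[].
move=> /(_ uSc); rewrite big_map.
under eq_integral do rewrite big_map.
move=> ->.
- congr (_ * _)%E; rewrite -prod_threshold -prodEFin; apply: eq_bigr => c _.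
  exact: Ex.
- move=> _ /mapP[c _ ->]; exact: measurable_tail.
- move=> _ k /mapP[c _ ->]; exact: preimage_tail_sigma.
- by move=> _ k; exact: presence_factor_ge0.
- by move=> _ /mapP[c _ ->]; rewrite Ex.
- by move=> _ _; exact: measurable_cell_event.
- by move=> i; rewrite inE => /eqP ->; exact: cell_event_sigma.
Qed.

Definition weighted_arrivals e w : R :=
  \prod_(p <- enum 'I_m.+1) cell_weight e p ^+ arrivals A (grid t m p) (grid t m p.+1) w.

Lemma measurable_weighted_arrivals e : measurable_fun setT (weighted_arrivals e).
Proof.
apply: measurable_prod => p _; apply: (measurable_fun_of_nat (GRing.exp _)).
exact: measurable_arrivals.
Qed.

Lemma weighted_arrivals_ge0 e w : 0 <= weighted_arrivals e w.
Proof. by apply: prodr_ge0 => p _; rewrite exprn_ge0// cell_weight_ge0. Qed.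

(** On the event of [s], the number of epochs in the cell [p] is the multiplicity
    of [p] in [s]. *)
Lemma integral_weighted_arrivals_cell e s :
  (\int[P]_(w in cell_event A t s) (weighted_arrivals e w)%:E =
   (\prod_(x <- s) cell_weight e x)%:E * P (cell_event A t s))%E.
Proof.
rewrite -integral_cst; last exact: measurable_cell_event.
apply: ge0_ae_eq_integral.
- exact: measurable_cell_event.
- by apply: measurable_funTS; apply/measurable_EFinP; exact: measurable_weighted_arrivals.
- exact: measurable_cst.
- by move=> w _; rewrite lee_fin weighted_arrivals_ge0.
- by move=> w _; rewrite lee_fin prodr_ge0// => p _; exact: cell_weight_ge0.
- apply: filterS (epochs_increasing pA) => w rw sw; congr (_%:E).
  rewrite /weighted_arrivals -prod_count_mem; apply: eq_bigr => p _.
  by rewrite (arrivals_cell p t0 rw sw).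
Qed.

Lemma integral_weighted_arrivals e :
  (\int[P]_w (weighted_arrivals e w)%:E =
   (expR (\sum_(p < m.+1) (cell_weight e p - 1) *
      \int[leb]_(u in `](grid t m p), (grid t m p.+1)]) r u))%:E)%E.
Proof.
pose x (i k : nat) : R := cell_weight e (inord i) ^+ k.
pose N i := arrivals A (grid t m i) (grid t m i.+1).
have Ex i : (\int[P]_w (x i (N i w))%:E = (expR ((cell_weight e (inord i) - 1) *
      \int[leb]_(u in `](grid t m i), (grid t m i.+1)]) r u))%:E)%E.
  by apply: (arrivals_pgf pA); [exact: grid_ge0|exact: grid_le|exact: cell_weight_ge0].
have ind : mutually_independent P (fun i : nat => g_sigma_algebra_preimage (N i)).
  apply: (independent_increments pA); first exact: grid_ge0.
  by move=> i j ij; exact: grid_le.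
have := @integral_prod_independent _ _ _ P nat _ N x (index_iota 0 m.+1) [::] (fun=> setT) ind.
rewrite big_nil mule1 cats0 (_ : \bigcap_(i in _) _ = setT); last first.
  by apply/seteqP; split.
move=> /(_ (iota_uniq _ _)) H.
have E w : weighted_arrivals e w = \prod_(0 <= i < m.+1) x i (N i w).
  rewrite /weighted_arrivals big_enum/= big_mkord.
  by apply: eq_bigr => p _; rewrite /x inord_val.
under eq_integral do rewrite E.
rewrite H.
- under eq_bigr do rewrite Ex.
  rewrite prodEFin big_mkord -expR_sum; congr (expR _)%:E.
  by apply: eq_bigr => p _; rewrite inord_val.
- by move=> i _; exact: measurable_arrivals.
- move=> i k _; exists [set k] => //; by rewrite setTI.
- by move=> i k; rewrite exprn_ge0// cell_weight_ge0.
- by move=> i _; rewrite Ex.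
- by [].
- by [].
Qed.

Lemma measurable_number_in_system : measurable_fun setT (number_in_system A S t).
Proof.
apply: (@measurable_card_fset_set _ _ ('I_Q0 + nat * 'I_n)%type
  (fun w => [set c | in_system A t S c w])) => c.
have mA : measurable_fun setT (arrival_time A c).
  by case: c => [j|[i l]]; [exact: measurable_cst|exact: measurable_funP].
have mb : measurable_fun setT (in_system A t S c).
  apply: measurable_and; first exact: measurable_fun_ler.
  by apply: measurable_fun_ltr => //; exact: measurable_funD.
rewrite (_ : [set _ | _] = in_system A t S c @^-1` [set true]); last by apply/seteqP; split.
by rewrite -[X in measurable X]setTI; exact: mb.
Qed.

Lemma exprn_count (I : Type) (a : pred I) (l : seq I) :
  (1 + z) ^+ count a l = \prod_(c <- l) presence_factor (a c).
Proof.
elim: l => [|c l IH]; first by rewrite big_nil.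
by rewrite big_cons -IH /= exprD; congr (_ * _); case: (a c).
Qed.

Lemma threshold_in_system s w c : regular_epochs A w -> cell_event A t s w ->
  c \in customers_upto Q0 n (size s) ->
  (threshold false s c < S c w -> in_system A t S c w) /\
  (in_system A t S c w -> threshold true s c < S c w).
Proof.
move=> rw [H L]; rewrite mem_customers_upto /in_system.
case: c => [j _|[i l] si] /=; first by rewrite add0r t0.
have /andP[gA Ag] := H i si.
have gt := grid_le_t t0 (ltn_ord (nth ord0 s i)).
rewrite addn0 addn1; split=> [?|/andP[? ?]]; last by lra.
by apply/andP; split; lra.
Qed.

Lemma presence_factor_le (b1 b2 : bool) : (b1 -> b2) ->
  (0 <= z -> presence_factor b1 <= presence_factor b2) /\
  (z <= 0 -> presence_factor b2 <= presence_factor b1).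
Proof. by case: b1; case: b2 => //= H; [have := H isT|split; lra]. Qed.

(** An earlier arrival makes presence at time [t] less likely, and presence
    decreases the product when [z < 0]. *)
Lemma shifted_product_sandwich s w : regular_epochs A w -> cell_event A t s w ->
  shifted_product (z < 0) s w <= (1 + z) ^+ number_in_system A S t w
    <= shifted_product (0 <= z) s w.
Proof.
move=> rw sw; rewrite (number_in_system_cell S t0 rw sw) exprn_count.
rewrite /shifted_product big_seq [X in _ <= X <= _]big_seq [X in _ <= _ <= X]big_seq.
have [z0|z0] := ltP z 0; apply/andP; split; apply: ler_prod => c cs;
  rewrite presence_factor_ge0/=; have [H1 H2] := threshold_in_system rw sw cs.
- by apply: (presence_factor_le H2).2; exact: ltW.
- by apply: (presence_factor_le H1).2; exact: ltW.
- exact: (presence_factor_le H1).1.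
- exact: (presence_factor_le H2).1.
Qed.

Definition discretised_gf e : R :=
  (1 + z * expR (- (mu * t))) ^+ Q0 *
  expR (\sum_(p < m.+1) (cell_weight e p - 1) *
      \int[leb]_(u in `](grid t m p), (grid t m p.+1)]) r u).

(** Summation of the inequalities over the lists of cells. *)
Lemma generating_function_sandwich :
  ((discretised_gf (z < 0)%R)%:E <=
    \int[P]_w ((1 + z) ^+ number_in_system A S t w)%:E <=
   (discretised_gf (0 <= z)%R)%:E)%E.
Proof.
(* The lists of cells are numbered by their codes; with pickle_inv, unlike
   unpickle, no list gets two numbers, so that the events are disjoint. *)
pose F k := if @pickle_inv (seq 'I_m.+1) k is Some s then cell_event A t s else set0.
have mF k : measurable (F k).
  by rewrite /F; case: pickle_inv => // s; exact: measurable_cell_event.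
have tF : trivIset setT F.
  move=> i j _ _ [w []]; rewrite /F.
  have := @pickle_invK (seq 'I_m.+1) i; case: pickle_inv => [s1 <-|//] w1.
  have := @pickle_invK (seq 'I_m.+1) j; case: pickle_inv => [s2 <-|//] w2.
  by rewrite (cell_event_inj t0 w1 w2).
have aeF : {ae P, forall w, exists k, F k w}.
  apply: filterS (epochs_increasing pA) => w /(cell_event_exists t m)[s sw].
  by exists (choice.pickle s); rewrite /F pickleK_inv.
have C0 : 0 <= (1 + z * expR (- (mu * t))) ^+ Q0.
  exact/exprn_ge0/tail_factor_ge0.
have mgf : measurable_fun setT (fun w => ((1 + z) ^+ number_in_system A S t w)%:E).
  apply/measurable_EFinP; apply: (measurable_fun_of_nat (GRing.exp _)).
  exact: measurable_number_in_system.
have gf0 w : (0 <= ((1 + z) ^+ number_in_system A S t w)%:E)%E.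
  by rewrite lee_fin exprn_ge0// -lerBlDl sub0r.
have mW e' : measurable_fun setT (fun w => (weighted_arrivals e' w)%:E).
  by apply/measurable_EFinP; exact: measurable_weighted_arrivals.
have DE e' : ((discretised_gf e')%:E = \sum_(k <oo)
   \int[P]_(w in F k) (((1 + z * expR (- (mu * t))) ^+ Q0)%:E * (weighted_arrivals e' w)%:E))%E.
  rewrite /discretised_gf EFinM -integral_weighted_arrivals -ge0_integralZl//.
  - apply: ge0_integral_ae_partition => //.
    + by apply: emeasurable_funM.
    + by move=> w; rewrite mule_ge0// lee_fin weighted_arrivals_ge0.
  - by move=> w _; rewrite lee_fin weighted_arrivals_ge0.
have DF e' s : (\int[P]_(w in cell_event A t s)
    (((1 + z * expR (- (mu * t))) ^+ Q0)%:E * (weighted_arrivals e' w)%:E) =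
    \int[P]_(w in cell_event A t s) (shifted_product e' s w)%:E)%E.
  rewrite ge0_integralZl//.
  - by rewrite integral_weighted_arrivals_cell integral_shifted_product EFinM muleA.
  - exact: measurable_cell_event.
  - exact: measurable_funTS.
  - by move=> w _; rewrite lee_fin weighted_arrivals_ge0.
have mSh e' s : measurable_fun (cell_event A t s) (fun w => (shifted_product e' s w)%:E).
  by apply: measurable_funTS; apply/measurable_EFinP; exact: measurable_shifted_product.
rewrite !DE (ge0_integral_ae_partition mF tF aeF)//.
apply/andP; split; apply: lee_nneseries => k.
- by move=> _ _; apply: integral_ge0 => w _; rewrite mule_ge0// lee_fin weighted_arrivals_ge0.
- move=> _; rewrite /F; case: pickle_inv => [s|]; last by rewrite !integral_set0.
  rewrite DF; apply: ae_ge0_le_integral => //.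
  + exact: measurable_cell_event.
  + by move=> w _; rewrite lee_fin shifted_product_ge0.
  + exact: measurable_funTS.
  + apply: filterS (epochs_increasing pA) => w rw sw; rewrite lee_fin.
    by have /andP[] := shifted_product_sandwich rw sw.
- by move=> _ _; apply: integral_ge0 => w _.
- move=> _; rewrite /F; case: pickle_inv => [s|]; last by rewrite !integral_set0.
  rewrite DF; apply: ae_ge0_le_integral => //.
  + exact: measurable_cell_event.
  + exact: measurable_funTS.
  + by move=> w _; rewrite lee_fin shifted_product_ge0.
  + apply: filterS (epochs_increasing pA) => w rw sw; rewrite lee_fin.
    by have /andP[] := shifted_product_sandwich rw sw.
Qed.

End sandwich.

(** * The limit of the bounds *)

Section riemann_sum.
Context {R : realType}.
Notation leb := (@lebesgue_measure R).

Lemma Rintegral_grid (f : R -> R) (t : R) m : 0 <= t ->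
  leb.-integrable `[0, t] (EFin \o f) ->
  \sum_(p < m.+1) \int[leb]_(u in `](grid t m p), (grid t m p.+1)]) f u =
  \int[leb]_(u in `[0, t]) f u.
Proof.
move=> t0 intf.
suff H k : (k <= m.+1)%N ->
    \sum_(p < k) \int[leb]_(u in `](grid t m p), (grid t m p.+1)]) f u =
    \int[leb]_(u in `[0, (grid t m k)]) f u.
  by rewrite H// grid_last.
elim: k => [|k IH] km; first by rewrite big_ord0 grid0 set_itv1 Rintegral_set1.
rewrite big_ord_recr/= IH 1?ltnW//.
rewrite -(Rintegral_itvB (x := grid t m k) (a := BLeft 0)) ?bnd_simp; last 3 first.
- apply: integrableS intf => //; apply: subset_itvl; rewrite bnd_simp.
  exact: grid_le_t.
- exact: grid_ge0.
- exact: grid_le.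
by rewrite addrC subrK.
Qed.

Lemma expN_lipschitz (x y : R) : 0 <= x -> 0 <= y ->
  `|expR (- x) - expR (- y)| <= `|x - y|.
Proof.
wlog xy : x y / x <= y.
  move=> H x0 y0; have [xy|/ltW yx] := leP x y; first exact: H.
  by rewrite distrC [leRHS]distrC; exact: H.
move=> x0 _; rewrite ger0_norm ?subr_ge0 ?ler_expR ?lerN2//.
rewrite distrC ger0_norm ?subr_ge0//.
have -> : expR (- x) - expR (- y) = expR (- x) * (1 - expR (- (y - x))).
  by rewrite mulrBr mulr1 -expRD; congr (_ - expR _); lra.
have h1 := expR_ge1Dx (- (y - x)).
have e1 : expR (- (y - x)) <= 1 by rewrite -expR0 ler_expR; lra.
have ex1 : expR (- x) <= 1 by rewrite -expR0 ler_expR; lra.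
apply: (@le_trans _ _ (1 - expR (- (y - x)))); last by lra.
by rewrite ler_piMl// subr_ge0.
Qed.

(** The exponential varies by at most [c t / (m + 1)] on a cell. *)
Lemma riemann_sum_error (r : R -> R) (c t : R) m (e : bool) : 0 < c -> 0 <= t ->
  (forall u, 0 <= r u) -> leb.-integrable `[0, t] (EFin \o r) ->
  `|\sum_(p < m.+1) expR (- (c * (t - grid t m (p + e)))) *
      \int[leb]_(u in `](grid t m p), (grid t m p.+1)]) r u -
    expR (- (c * t)) * \int[leb]_(u in `[0, t]) (r u * expR (c * u))| <=
  c * t * (\int[leb]_(u in `[0, t]) r u) * m.+1%:R^-1.
Proof.
move=> c0 t0 r0 intr.
have intre : leb.-integrable `[0, t] (EFin \o (fun u => r u * expR (c * u))).
  by apply: integrable_mul_continuous => //; exact: continuous_expM.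
have sub p : (p < m.+1)%N -> `](grid t m p), (grid t m p.+1)] `<=` `[0, t].
  move=> pm u /=; rewrite !in_itv/= => /andP[gu ug].
  rewrite (le_trans (grid_ge0 m p t0) (ltW gu))/= (le_trans ug)//.
  exact: (@grid_le_t _ t m p.+1).
rewrite -(Rintegral_grid m t0 intre) -(Rintegral_grid m t0 intr).
rewrite [X in _ - X]mulr_sumr -sumrB mulr_sumr mulr_suml.
apply: (le_trans (ler_norm_sum _ _ _)); apply: ler_sum => -[p pm] _ /=.
have [intr' intre'] : leb.-integrable `](grid t m p), (grid t m p.+1)] (EFin \o r) /\
    leb.-integrable `](grid t m p), (grid t m p.+1)] (EFin \o (fun u => r u * expR (c * u))).
  by split; [apply: integrableS intr => //|apply: integrableS intre => //]; exact: sub.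
set E := expR _; set J := `](grid t m p), _]%classic.
have mJ : measurable (J : set (measurableTypeR R)) by exact: measurable_itv.
rewrite -(RintegralZl _ mJ intr') -(RintegralZl _ mJ intr') -(RintegralZl _ mJ intre').
have iZ (f : R -> R) k : leb.-integrable J (EFin \o f) ->
    leb.-integrable J (EFin \o (fun u => k * f u)).
  by move=> fi; have := integrableZl mJ k fi; apply: (eq_integrable mJ).
have iD : leb.-integrable J (EFin \o (fun u => E * r u - expR (- (c * t)) * (r u * expR (c * u)))).
  have := integrableB mJ (iZ _ E intr') (iZ _ (expR (- (c * t))) intre').
  exact: (eq_integrable mJ).
rewrite -RintegralB//; [|exact: iZ|exact: iZ].
apply: (le_trans (le_normr_Rintegral mJ iD)) => //.
rewrite -RintegralZr//; last exact: iZ.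
apply: le_Rintegral => //.
- by have := integrable_abse iD; apply: (eq_integrable mJ).
- have := iZ _ (m.+1%:R^-1) (iZ _ (c * t) intr'); apply: (eq_integrable mJ) => // u _ /=.
  by rewrite mulrC.
move=> u; rewrite /J /= in_itv/= => /andP[gu ug].
have gt : grid t m p.+1 <= t by exact: grid_le_t.
have -> : E * r u - expR (- (c * t)) * (r u * expR (c * u)) =
    (E - expR (- (c * (t - u)))) * r u.
  by rewrite mulrBl mulrCA -expRD [r u * expR _]mulrC; congr (_ - expR _ * _); ring.
rewrite normrM (ger0_norm (r0 u)) mulrAC ler_wpM2r//.
have ge : grid t m (p + e) <= t.
  case: e {E intre' intr' iZ iD}; rewrite ?addn1 ?addn0//.
  exact: le_trans (grid_le m t0 (leqnSn p)) gt.
apply: (le_trans (expN_lipschitz _ _)).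
- by rewrite mulr_ge0 ?subr_ge0// ltW.
- by rewrite mulr_ge0 ?subr_ge0 ?(le_trans ug)// ltW.
rewrite -mulrBr normrM (gtr0_norm c0) -mulrA ler_wpM2l//; first exact: ltW.
have gS : grid t m p.+1 = grid t m p + t / m.+1%:R.
  by rewrite /grid -natr1 mulrDl mul1r.
rewrite ler_norml; move: gS gu ug; case: e {E intre' intr' iZ iD ge}; rewrite ?addn1 ?addn0;
  move: (t / m.+1%:R) (grid t m p.+1) (grid t m p) => x y v; lra.
Qed.

End riemann_sum.

Section limit.
Context {R : realType}.
Notation leb := (@lebesgue_measure R).

Lemma cell_weight_binomial (t mu z : R) n m (e : bool) (p : 'I_m.+1) :
  cell_weight t n mu z e p - 1 =
  \sum_(1 <= j < n.+1) 'C(n, j)%:R * z ^+ j *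
    expR (- (j%:R * mu * (t - grid t m (p + e)))).
Proof.
rewrite /cell_weight exprDn; set y := z * _.
rewrite -(big_mkord xpredT (fun i => 1 ^+ (n - i) * y ^+ i *+ 'C(n, i))) big_nat_recl//.
rewrite subn0 expr1n expr0 bin0 mul1r mulr1n addrC addKr.
rewrite big_add1; apply: eq_bigr => j _.
rewrite expr1n mul1r /y exprMn -expRM_natl -[LHS]mulr_natl mulrA; congr (_ * expR _).
by rewrite mulrN mulrA.
Qed.

Lemma riemann_sum_cvg (r : R -> R) (c t : R) (e : bool) : 0 < c -> 0 <= t ->
  (forall u, 0 <= r u) -> leb.-integrable `[0, t] (EFin \o r) ->
  \sum_(p < m.+1) expR (- (c * (t - grid t m (p + e)))) *
      \int[leb]_(u in `](grid t m p), (grid t m p.+1)]) r u @[m --> \oo] -->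
  expR (- (c * t)) * \int[leb]_(u in `[0, t]) (r u * expR (c * u)).
Proof.
move=> c0 t0 r0 intr; apply/subr_cvg0; apply: norm_cvg0.
apply: (@squeeze_cvgr _ _ _ _ (fun=> 0)
  (fun m => (c * t * (\int[leb]_(u in `[0, t]) r u)) * m.+1%:R^-1)).
- by apply: nearW => m; rewrite normr_ge0/=; exact: riemann_sum_error.
- exact: cvg_cst.
- rewrite -[X in _ --> X](mulr0 (c * t * (\int[leb]_(u in `[0, t]) r u))).
  by apply: cvgMl_tmp; exact: cvg_harmonic.
Qed.

Lemma discretised_gf_cvg (r : R -> R) (t mu z : R) Q0 n (e : bool) :
  0 < mu -> 0 <= t -> (forall u, 0 <= r u) -> leb.-integrable `[0, t] (EFin \o r) ->
  discretised_gf t m Q0 n mu z r e @[m --> \oo] -->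
  (1 + z * expR (- (mu * t))) ^+ Q0 *
  expR (\sum_(1 <= j < n.+1) 'C(n, j)%:R * z ^+ j *
    (expR (- (j%:R * mu * t)) * \int[leb]_(u in `[0, t]) (r u * expR (j%:R * mu * u)))).
Proof.
move=> mu0 t0 r0 intr; apply: cvgMl_tmp.
apply: continuous_cvg; first exact: continuous_expR.
rewrite (_ : (fun m => _) = (fun m => \sum_(1 <= j < n.+1) 'C(n, j)%:R * z ^+ j *
   \sum_(p < m.+1) expR (- (j%:R * mu * (t - grid t m (p + e)))) *
      \int[leb]_(u in `](grid t m p), (grid t m p.+1)]) r u)); last first.
  apply/funext => m; under [RHS]eq_bigr do rewrite mulr_sumr.
  rewrite exchange_big/=; apply: eq_bigr => p _.
  by rewrite cell_weight_binomial mulr_suml; apply: eq_bigr => j _; rewrite mulrA.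
rewrite big_add1; under eq_cvg do rewrite big_add1.
apply: cvg_big => [|j _]; first exact: add_continuous.
by apply: cvgMl_tmp; apply: riemann_sum_cvg => //; rewrite mulr_gt0.
Qed.

End limit.

(** * The number in system *)

Section generating_function.
Context d (T : measurableType d) (R : realType) (P : probability T R).
Notation leb := (@lebesgue_measure R).

Lemma generating_function_number_in_system (r : R -> R) (mu z t : R) (n Q0 : nat)
    (A : nat -> {RV P >-> R}) (S : customer Q0 n -> {RV P >-> R}) :
  0 < mu -> 0 <= t -> -1 <= z -> (forall u, 0 <= r u) ->
  locally_integrable setT r -> infinite_server_queue r mu A S ->
  (\int[P]_w ((1 + z) ^+ number_in_system A S t w)%:E =
   ((1 + z * expR (- (mu * t))) ^+ Q0 *
    expR (\sum_(1 <= j < n.+1) 'C(n, j)%:R * z ^+ j *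
     (expR (- (j%:R * mu * t)) *
      \int[leb]_(u in `[0, t]) (r u * expR (j%:R * mu * u)))))%:E)%E.
Proof.
move=> mu0 t0 z1 r0 rl queue.
have sw m := generating_function_sandwich m t0 mu0 z1 queue.
have lim e := @discretised_gf_cvg R r t mu z Q0 n e mu0 t0 r0 (locally_integrable_itv 0 t rl).
set L := _ * _ in lim *; move: sw; set I := integral _ _ _ => sw.
have [y Iy] : exists y, I = y%:E.
  have /andP[] := sw 0%N; case: I {sw} => [y _ _|//|//].
  by exists y.
rewrite Iy; congr (_%:E).
have cy : (fun=> y) @ \oo --> L.
  apply: (@squeeze_cvgr _ _ _ _ _ _ _ _ _ (lim (z < 0)) (lim (0 <= z))).
  by apply: nearW => m; have := sw m; rewrite Iy !lee_fin.
by have /cvg_lim <- // := cy; rewrite lim_cst.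
Qed.

End generating_function.

Theorem proposition2p1 (d : measure_display) (T : measurableType d)
  (R : realType) (P : probability T R)
  (r : R -> R) (lambda : R) (a b : nat -> R) (mu : R) (n Q0 : nat)
  (A : nat -> {RV P >-> R}) (S : customer Q0 n -> {RV P >-> R})
  (r_gt0 : forall u, 0 < r u)
  (r_locint : locally_integrable setT r)
  (r_periodic : periodic r (pi *+ 2))
  (r_fourier : fourier_coefficients r lambda a b)
  (mu_gt0 : 0 < mu) (n_gt0 : (0 < n)%N)
  (queue : infinite_server_queue r mu A S)
  (theta t : R) (t_ge0 : 0 <= t) :
  [/\ forall j : nat, (1 <= j <= n)%N -> cvgn (fun N : nat =>
        \sum_(1 <= k < N)
          ((a k * j%:R * mu - b k * k%:R) / (k%:R ^+ 2 + j%:R ^+ 2 * mu ^+ 2) *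
           (cos (k%:R * t) - expR (- (j%:R * mu * t))))),
      forall j : nat, (1 <= j <= n)%N -> cvgn (fun N : nat =>
        \sum_(1 <= k < N)
          ((a k * k%:R + b k * j%:R * mu) * sin (k%:R * t) /
           (k%:R ^+ 2 + j%:R ^+ 2 * mu ^+ 2))) &
      'M_P (fun w => (number_in_system A S t w)%:R) theta =
      ((expR (- (mu * t)) * (expR theta - 1) + 1) ^+ Q0 *
       expR (\sum_(1 <= j < n.+1) 'C(n, j)%:R * (expR theta - 1) ^+ j *
         (lambda / (j%:R * mu) * (1 - expR (- (j%:R * mu * t))) +
          \big[+%R/0]_(1 <= k <oo)
            ((a k * j%:R * mu - b k * k%:R) / (k%:R ^+ 2 + j%:R ^+ 2 * mu ^+ 2) *
             (cos (k%:R * t) - expR (- (j%:R * mu * t)))))) *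
       expR (\sum_(1 <= j < n.+1) 'C(n, j)%:R * (expR theta - 1) ^+ j *
         \big[+%R/0]_(1 <= k <oo)
           ((a k * k%:R + b k * j%:R * mu) * sin (k%:R * t) /
            (k%:R ^+ 2 + j%:R ^+ 2 * mu ^+ 2))))%:E].
Proof.
have r_ge0 u : 0 <= r u by exact: ltW.
have series j : (1 <= j <= n)%N -> exists lc ls : R,
    [/\ \sum_(1 <= k < N) ((a k * j%:R * mu - b k * k%:R) / (k%:R ^+ 2 + j%:R ^+ 2 * mu ^+ 2) *
           (cos (k%:R * t) - expR (- (j%:R * mu * t)))) @[N --> \oo] --> lc,
        \sum_(1 <= k < N) ((a k * k%:R + b k * j%:R * mu) * sin (k%:R * t) /
           (k%:R ^+ 2 + j%:R ^+ 2 * mu ^+ 2)) @[N --> \oo] --> ls &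
        expR (- (j%:R * mu * t)) *
          \int[lebesgue_measure]_(u in `[0, t]) (r u * expR (j%:R * mu * u)) =
        lambda / (j%:R * mu) * (1 - expR (- (j%:R * mu * t))) + lc + ls].
  move=> /andP[j0 _]; have c0 : 0 < j%:R * mu by rewrite mulr_gt0// ltr0n.
  have [lc [ls [Hc Hs E]]] := convolution_series c0 t_ge0 r_ge0 r_locint r_periodic r_fourier.
  exists lc, ls; split => //.
  - rewrite (_ : (fun N => _) = (fun N => \sum_(1 <= k < N)
      convolution_cos (j%:R * mu) a b k * (cos (k%:R * t) - expR (- (j%:R * mu * t)))))//.
    apply/funext => N; apply: eq_bigr => k _.
    by rewrite /convolution_cos exprMn mulrA.
  - rewrite (_ : (fun N => _) = (fun N => \sum_(1 <= k < N)
      convolution_sin (j%:R * mu) a b k * sin (k%:R * t)))//.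
    apply/funext => N; apply: eq_bigr => k _.
    by rewrite /convolution_sin exprMn mulrA mulrAC.
split.
- by move=> j /series[lc [ls [Hc _ _]]]; apply: cvgP Hc.
- by move=> j /series[lc [ls [_ Hs _]]]; apply: cvgP Hs.
have z1 : -1 <= expR theta - 1 by have := expR_ge0 theta; lra.
have := generating_function_number_in_system mu_gt0 t_ge0 z1 r_ge0 r_locint queue.
rewrite addrC subrK => E.
rewrite /mmt_gen_fun unlock.
rewrite (_ : (fun w => _) = (fun w => (expR theta ^+ number_in_system A S t w)%:E)); last first.
  by apply/funext => w /=; rewrite -expRM_natl.
rewrite E; congr (_%:E); rewrite -mulrA -expRD; congr (_ * expR _).
  by congr (_ ^+ _); rewrite addrC mulrC.
rewrite -big_split/=; apply: eq_big_nat => j jn; rewrite -mulrDr; congr (_ * _).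
have [lc [ls [Hc Hs ->]]] := series j jn.
by move/cvg_lim : Hc => ->//; move/cvg_lim : Hs => ->.
Qed.
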